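(* Let $q\ge1$, $0\le p<q+1$, let $\alpha_1,\dots,\alpha_p\in\mathbb{C}$ and $\beta_1,\dots,\beta_q\in\mathbb{C}$ with $\mathrm{Re}\,\beta_j>1$ for all $j$, and let $t\in\mathbb{R}$. Then the confluent hypergeometric function $F(t)={}_pF_q(\alpha_1,\dots,\alpha_p;\beta_1,\dots,\beta_q;t)$ satisfies $$F(t)=C\int \mathrm{d}^q\tau\ \prod_{i=1}^{q}(1-\tau_i)^{\beta_i-2}\ \mathrm{Res}\ \prod_{j=1}^{p}(1-a_j\eta)^{-\alpha_j}\ \exp\!\left[\eta\, t^{\kappa}(a_{p+1}+\dots+a_{q+1})\right]\frac{\mathrm{d}^{q+1}\ln a}{\mathrm{d}\ln(a_1\cdots a_{q+1})},$$ where $\eta=\eta(\tau)=(\tau_1\cdots\tau_q)^{1/(q+1)}$, $\kappa=\frac1{q+1-p}$, $C=\prod_{i=1}^q(\beta_i-1)$, and the integral $\int \mathrm{d}^q\tau$ runs over the hypercube $\{0<\tau_i<1:\ i=1,\dots,q\}$.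
   Context: The generalized hypergeometric series is $${}_pF_q(\alpha_1,\dots,\alpha_p;\beta_1,\dots,\beta_q;t)=\sum_{n\ge0}\frac{(\alpha_1)_n\cdots(\alpha_p)_n}{(\beta_1)_n\cdots(\beta_q)_n}\frac{t^n}{n!},$$ with $(\alpha)_0=1$, $(\alpha)_n=\alpha(\alpha+1)\cdots(\alpha+n-1)$; it is called confluent if $p<q+1$, and then it converges in the whole complex plane. Residuum: $\mathrm{Res}$ of a holomorphic $q$-form $\omega$ near the torus below means $\left(\frac{1}{2\pi \mathrm{i}}\right)^q\int\omega$ over the fundamental $q$-dimensional cycle $\{|a_1|=\dots=|a_{q+1}|=1\}$ of the hypersurface $\{a_1\cdots a_{q+1}=1\}\simeq(\mathbb{C}^* )^q$. Here $\mathrm{d}^{q+1}\ln a=\frac{\mathrm{d}a_1}{a_1}\wedge\cdots\wedge\frac{\mathrm{d}a_{q+1}}{a_{q+1}}$, and $\mathrm{d}^{q+1}\ln a/\mathrm{d}\ln(a_1\cdots a_{q+1})$ is the Gelfand--Leray form, i.e. the $q$-form $\theta$ on the hypersurface with $\theta\wedge \mathrm{d}\ln(a_1\cdots a_{q+1})=\mathrm{d}^{q+1}\ln a$; in the coordinates $a_1,\dots,a_q$ on the hypersurface it is $\frac{\mathrm{d}a_1}{a_1}\wedge\cdots\wedge\frac{\mathrm{d}a_q}{a_q}$, and the cycle is oriented so that $\mathrm{Res}$ of this form equals $1$. The powers $(1-a_j\eta)^{-\alpha_j}$ are principal branches (equal to $1$ at $\eta=0$), $\eta$ is the positive root, and $t^\kappa$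 is any fixed choice of the root. *)

(* Defs.v *)
From HB Require Import structures.
From mathcomp Require Import all_boot all_order all_algebra.
From mathcomp Require Import all_classical all_reals all_analysis.
From mathcomp Require Import complex.

Set Implicit Arguments.
Unset Strict Implicit.
Unset Printing Implicit Defensive.

Import Order.TTheory GRing.Theory Num.Theory.
Import numFieldNormedType.Exports.

Local Open Scope classical_set_scope.
Local Open Scope ring_scope.
Local Open Scope complex_scope.

(** Lebesgue measure on [R^n], with [n.-tuple R] as model of [R^n] (carrying the
    product sigma-algebra of the library): iterated product measure, transported
    along [R * R^n -> R^n+1]. *)
Definition tuple_cons (R : realType) n (x : R * n.-tuple R) : n.+1.-tuple R :=
  [the n.+1.-tuple R of x.1 :: x.2].

Lemma measurable_tuple_cons (R : realType) n :
  measurable_fun setT (@tuple_cons R n).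
Proof. exact: (measurable_cons measurable_fst measurable_snd). Qed.

Section cons_measure.
Local Open Scope ereal_scope.
Context (R : realType) (n : nat).
Variable m : {sigma_finite_measure set (n.-tuple R) -> \bar R}.

Definition cons_measure : set (n.+1.-tuple R) -> \bar R :=
  pushforward (@lebesgue_measure R \x m) (@tuple_cons R n).

Let cons_measure0 : cons_measure set0 = 0.
Proof. by rewrite /cons_measure /pushforward preimage_set0 measure0. Qed.

Let cons_measure_ge0 A : 0 <= cons_measure A.
Proof. exact: (measure_ge0 (@lebesgue_measure R \x m)). Qed.

Let cons_measure_additive : semi_sigma_additive cons_measure.
Proof.
have mc := @measurable_tuple_cons R n.
move=> F mF tF mUF; rewrite /cons_measure /pushforward preimage_bigcup.
apply: (measure_semi_sigma_additive (s := @lebesgue_measure R \x m)).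
- by move=> k; rewrite -[X in measurable X]setTI; exact: mc.
- apply/trivIsetP => /= i j _ _ ij; rewrite -preimage_setI.
  by move/trivIsetP : tF => /(_ _ _ _ _ ij) ->//; rewrite preimage_set0.
- by rewrite -preimage_bigcup -[X in measurable X]setTI; exact: mc.
Qed.

HB.instance Definition _ := isMeasure.Build _ _ _ cons_measure
  cons_measure0 cons_measure_ge0 cons_measure_additive.

Let cons_measure_sigma_finite : sigma_finite setT cons_measure.
Proof.
have /sigma_finiteP[F [TF ndF Foo]] := sigma_finiteT (@lebesgue_measure R).
have /sigma_finiteP[G [TG ndG Goo]] := sigma_finiteT m.
pose u (y : n.+1.-tuple R) := (thead y, [tuple of behead y]).
have uK : cancel (@tuple_cons R n) u.
  by case=> x s; congr pair; apply/val_inj.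
have mu : measurable_fun setT u.
  by apply: measurable_fun_pair; [exact: measurable_tnth|exact: measurable_behead].
exists (fun k => u @^-1` (F k `*` G k)) => [|k].
  rewrite -preimage_bigcup -[LHS](@preimage_setT _ _ u); congr preimage.
  rewrite -setXTT TF TG predeqE => -[x y]; split.
    move=> [/= [i _ Fx] [j _ Gy]]; exists (maxn i j) => //; split.
    - by move: x Fx; exact/subsetPset/ndF/leq_maxl.
    - by move: y Gy; exact/subsetPset/ndG/leq_maxr.
  by move=> [i _ []/= ? ?]; split; exists i.
have [mF Fk] := Foo k; have [mG Gk] := Goo k; split.
  by rewrite -[X in measurable X]setTI; apply: mu => //; exact: measurableX.
rewrite /cons_measure /pushforward -comp_preimage.
rewrite (_ : u \o _ = id); last by apply/funext.
by rewrite preimage_id product_measure1E// lte_mul_pinfty// ge0_fin_numE.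
Qed.

HB.instance Definition _ :=
  Measure_isSigmaFinite.Build _ _ _ cons_measure cons_measure_sigma_finite.

End cons_measure.

Fixpoint lebesgue_tuple (R : realType) (n : nat) :
    {sigma_finite_measure set (n.-tuple R) -> \bar R} :=
  match n with
  | 0 => (dirac [tuple] : {sigma_finite_measure set (0.-tuple R) -> \bar R})
  | k.+1 => cons_measure (lebesgue_tuple R k)
  end.

Lemma lebesgue_tuple_box (R : realType) n (A : 'I_n -> set R) :
  (forall i, measurable (A i)) ->
  (lebesgue_tuple R n [set x | forall i, A i (tnth x i)] =
   \prod_(i < n) lebesgue_measure (A i))%E.
Proof.
elim: n A => [|n IH] A mA.
  by rewrite big_ord0 /= diracE mem_set//= => -[].
rewrite big_ord_recl -IH//.
set B := [set x : n.-tuple R | _].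
have mB : measurable B.
  rewrite (_ : B = \bigcap_(i in [set: 'I_n]) ((@tnth n R ^~ i) @^-1` A (lift ord0 i))).
    apply: fin_bigcap_measurable => // i _; rewrite -[X in measurable X]setTI.
    by apply: measurable_tnth.
  by apply/seteqP; split=> [x Bx i _|x Bx i]; exact: Bx.
rewrite -(@product_measure1E _ _ _ _ _ (@lebesgue_measure R))//; last exact: mA.
rewrite /= /cons_measure /pushforward; congr (_ \x _)%E.
apply/seteqP; split=> -[x s]/=.
  move=> h; split; first exact: (h ord0).
  by move=> i; have := h (lift ord0 i); rewrite tnthS.
move=> [Ax Bs] i; case: (unliftP ord0 i) => [j|] ->; last exact: Ax.
by rewrite tnthS; exact: Bs.
Qed.

Section complex_functions.
Variable R : realType.
Implicit Types z a : R[i].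

Definition cexp z : R[i] :=
  (expR (complex.Re z))%:C * (cos (complex.Im z) +i* sin (complex.Im z)).

Lemma cexp_neq0 z : cexp z != 0.
Proof.
rewrite mulf_neq0//; first by rewrite eq_complex /= gt_eqF ?expR_gt0.
apply/eqP => -[c0 s0]; have := cos2Dsin2 (complex.Im z).
by rewrite c0 s0 !expr0n addr0 => /eqP; rewrite eq_sym oner_eq0.
Qed.

(** Principal argument, in [ ]-pi, pi] ] for [z != 0]. *)
Definition carg z : R :=
  let c := acos (complex.Re z / ComplexField.Normc.normc z) in
  if 0 <= complex.Im z then c else - c.

Definition cln z : R[i] := ln (ComplexField.Normc.normc z) +i* carg z.

(** Principal branch of [z ^ a]; at [z = 0] the convention of [powR]. *)
Definition cpow z a : R[i] :=
  if z == 0 then (a == 0)%:R else cexp (a * cln z).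

Definition pochhammer a (n : nat) : R[i] := \prod_(i < n) (a + i%:R).

(** [R[i]^o] is [R[i]] with the topology of its norm. *)
Definition hypergeometric p q (al : 'I_p -> R[i]) (be : 'I_q -> R[i]) (t : R[i])
    : R[i] :=
  limn (series (fun n =>
    (\prod_(j < p) pochhammer (al j) n) / (\prod_(j < q) pochhammer (be j) n)
    * (t ^+ n / n`!%:R) : R[i]^o)).

End complex_functions.

Section complex_integral.
Context d (T : measurableType d) (R : realType).
Variable mu : {measure set T -> \bar R}.
Implicit Types (D : set T) (f : T -> R[i]).

Definition cintegrable D f : Prop :=
  mu.-integrable D (fun x => (complex.Re (f x))%:E) /\
  mu.-integrable D (fun x => (complex.Im (f x))%:E).

Definition cintegral D f : R[i] :=
  (\int[mu]_(x in D) complex.Re (f x)) +i* (\int[mu]_(x in D) complex.Im (f x)).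

End complex_integral.

Section residue.
Variables (R : realType) (q : nat).
Implicit Types (a : 'rV[R[i]]_q.+1) (V : 'M[R[i]]_(q, q.+1)).

(** A [q]-form on [C^(q+1)]: its value at the point [a] on the [q] tangent vectors
    given by the rows of [V]. *)
Definition qform := 'rV[R[i]]_q.+1 -> 'M[R[i]]_(q, q.+1) -> R[i].

(** [dln (a_1 ... a_(q+1))] at [a], on the tangent vector [v]. *)
Definition dln_prod a (v : 'rV[R[i]]_q.+1) : R[i] := \sum_j v 0 j / a 0 j.

(** [d^(q+1) ln a] at [a], on the rows of [W]. *)
Definition dln_all a (W : 'M[R[i]]_q.+1) : R[i] :=
  \det (\matrix_(i, j) (W i j / a 0 j)).

(** [d^(q+1) ln a / dln (a_1 ... a_(q+1))], in the coordinates [a_1, ..., a_q]: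
    [da_1/a_1 /\ ... /\ da_q/a_q]. *)
Definition gelfand_leray : qform := fun a V =>
  \det (\matrix_(i < q, j < q)
          (V i (widen_ord (leqnSn q) j) / a 0 (widen_ord (leqnSn q) j))).

(** The defining property [gelfand_leray /\ dln_prod = dln_all]. *)
Lemma gelfand_lerayP a (W : 'M[R[i]]_q.+1) :
  \sum_(k < q.+1)
     (-1) ^+ (k + q) * gelfand_leray a (row' k W) * dln_prod a (row k W)
  = dln_all a W.
Proof.
pose U : 'M[R[i]]_q.+1 := \matrix_(i, j) ((j == ord_max) || (i == j))%:R.
have detU : \det U = 1.
  rewrite -det_tr det_trig; last first.
    apply/is_trig_mxP => i j ij; rewrite !mxE.
    rewrite [j == i]gt_eqF// orbF; case: eqP ij => // ->.
    by rewrite ltnNge -ltnS ltn_ord.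
  by rewrite big1// => i _; rewrite !mxE eqxx orbT.
rewrite /dln_all -[RHS]mulr1 -[X in _ * X]detU -det_mulmx (expand_det_col _ ord_max).
apply: eq_bigr => k _; rewrite mulrC; congr (_ * _).
  rewrite /dln_prod !mxE; apply: eq_bigr => j _.
  by rewrite !mxE eqxx mulr1.
rewrite /cofactor /gelfand_leray; congr (_ * \det _); apply/matrixP => i j.
have wE : lift ord_max j = widen_ord (leqnSn q) j.
  by apply/val_inj; exact: lift_max.
rewrite !mxE wE (bigD1 (widen_ord (leqnSn q) j))//= !mxE eqxx orbT mulr1.
rewrite big1 ?addr0// => l lj; rewrite !mxE (negbTE lj) orbF.
by rewrite lt_eqF ?mulr0// ltEord /= ltn_ord.
Qed.

(** The cycle [|a_1| = ... = |a_(q+1)| = 1] of the hypersurface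
    [a_1 ... a_(q+1) = 1], parametrized by the arguments [phi_1, ..., phi_q] in
    [ [0, 2 pi] ] of [a_1, ..., a_q]; the argument of [a_(q+1)] is then
    [- (phi_1 + ... + phi_q)].  [torus_arg k j] is the coefficient of [phi_k] in
    the argument of [a_j]. *)
Definition torus_arg : 'M[R]_(q, q.+1) :=
  \matrix_(k, j) ((widen_ord (leqnSn q) k == j)%:R - (j == ord_max)%:R).

Definition torus (phi : q.-tuple R) : 'rV[R[i]]_q.+1 :=
  \row_j cexp ((\sum_k torus_arg k j * tnth phi k)%:C * 'i).

(** Row [k] is the derivative of [torus] with respect to [phi_k]. *)
Definition dtorus (phi : q.-tuple R) : 'M[R[i]]_(q, q.+1) :=
  \matrix_(k, j) ((torus_arg k j)%:C * 'i * torus phi 0 j).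

(** Integral of the pullback of [omega] by [torus].  The orientation is that of
    [phi_1, ..., phi_q], for which the Gelfand-Leray form has residuum 1. *)
Definition Res (omega : qform) : R[i] :=
  (2 * pi%:C * 'i)^-1 ^+ q *
  cintegral (lebesgue_tuple R q)
    [set phi : q.-tuple R | forall k, 0 <= tnth phi k <= 2 * pi]
    (fun phi => omega (torus phi) (dtorus phi)).

Lemma Res_gelfand_leray : Res gelfand_leray = 1.
Proof.
have GLE phi : gelfand_leray (torus phi) (dtorus phi) = 'i ^+ q.
  rewrite /gelfand_leray.
  transitivity (\det ('i%:M : 'M[R[i]]_q)); last by rewrite det_scalar.
  congr (\det _); apply/matrixP => k j; rewrite !mxE.
  have -> : (widen_ord (leqnSn q) j == ord_max) = false.
    by rewrite lt_eqF// ltEord /= ltn_ord.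
  rewrite subr0 mulfK; last exact: cexp_neq0.
  have -> : (widen_ord (leqnSn q) k == widen_ord (leqnSn q) j) = (k == j) by [].
  by case: eqP => _; rewrite ?mulr1n ?mul1r ?mulr0n ?mul0r.
rewrite /Res; set D := [set phi | _].
have DE : D = [set phi | forall k, `[0, 2 * pi]%classic (tnth phi k)].
  by apply/seteqP; split=> phi /= Dphi k; have := Dphi k; rewrite /= in_itv.
have mD : measurable D.
  rewrite (_ : D = \bigcap_(i in [set: 'I_q]) ((@tnth q R ^~ i) @^-1` `[0, 2 * pi]%classic)).
    apply: fin_bigcap_measurable => // i _; rewrite -[X in measurable X]setTI.
    by apply: measurable_tnth.
  by rewrite DE; apply/seteqP; split=> [x Bx i _|x Bx i]; exact: Bx.
have muD : lebesgue_tuple R q D = ((2 * pi) ^+ q)%:E.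
  rewrite DE (@lebesgue_tuple_box R q (fun=> `[0, 2 * pi]%classic))//.
  under eq_bigr do rewrite lebesgue_measure_itv /= lte_fin mulr_gt0 ?pi_gt0// sube0.
  by rewrite prodEFin prodr_const card_ord.
have cE c : cintegral (lebesgue_tuple R q) D (fun=> c) = ((2 * pi) ^+ q)%:C * c.
  have cR r : \int[lebesgue_tuple R q]_(x in D) r = r * (2 * pi) ^+ q.
    by rewrite Rintegral_cst//; congr (_ * _); apply: (congr1 fine muD).
  rewrite /cintegral !cR.
  by case: c => x y; apply/eqP; rewrite eq_complex /= !mul0r subr0 addr0 ![_ ^+ q * _]mulrC !eqxx.
rewrite (_ : (fun phi => _) = (fun=> 'i ^+ q)); last exact/funext.
have two_pi : (2 * pi : R)%:C = 2 * pi%:C by rewrite rmorphM rmorph_nat.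
rewrite cE rmorphXn /= two_pi -!exprMn mulVf ?expr1n//.
by rewrite -two_pi mulf_neq0// eq_complex /= ?oner_eq0 ?andbF// gt_eqF// mulr_gt0 ?pi_gt0.
Qed.

End residue.

Definition hypercube (R : realType) q : set (q.-tuple R) :=
  [set tau | forall i, 0 < tnth tau i < 1].
Arguments hypercube : clear implicits.

Definition eta_of (R : realType) q (tau : q.-tuple R) : R :=
  (\prod_(i < q) tnth tau i) `^ q.+1%:R^-1.

(* Main.v *)
(** Each factor of the integrand is expanded in a power series in [a_j eta]: the
    binomial series for [j <= p], the exponential series for [j > p].  On the
    torus [a_1 ... a_(q+1) = 1] the residuum of [a_1^n_1 ... a_(q+1)^n_(q+1)] is
    [1] if all the exponents are equal and [0] otherwise, so that [Res] is
    [sum_n (alpha_1)_n ... (alpha_p)_n t^n / n!^(q+1) (tau_1 ... tau_q)^n].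
    The integral over the hypercube then splits into the Beta integrals
    [int_0^1 (1 - x)^(beta - 2) x^n dx = n! / ((beta - 1) (beta)_n)].
    Both interchanges of sum and integral are by dominated convergence. *)
Require Import Defs.
From HB Require Import structures.
From mathcomp Require Import all_boot all_order all_algebra.
From mathcomp Require Import all_classical all_reals all_analysis.
From mathcomp Require Import complex.
From mathcomp Require Import measurable_realfun ring lra.
Import Order.TTheory GRing.Theory Num.Theory.
Import numFieldNormedType.Exports.
Local Open Scope classical_set_scope.
Local Open Scope ring_scope.
Local Open Scope complex_scope.

(** The two uses of dominated convergence need different bounds. On the torus [eta < 1] is fixed,
    and each factor is bounded by its absolute Taylor series at radius [eta]. That bound degenerates
    as [eta] tends to 1, the edge of the disc of the binomial series, so it cannot serve on the
    hypercube. There the bound is put on the coefficients left after taking the residuum: as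
    [p < q + 1], at least one factor is an exponential, its [1/n!] outweighs the growth of all the
    others, and the remaining series converges absolutely even at [tau = (1, ..., 1)]. The majorant
    is then a constant times the modulus of the product of the [(1 - tau_i)^(beta_i - 2)],
    integrable because [Re beta_i > 1].

    The Taylor expansions are proved along a ray [z = w r] with [r] real: the sum of the series and
    the closed form solve the same linear differential equation in [r], so that calculus of real and
    imaginary parts suffices. The Beta integrals, with complex [b = beta - 1], start from the
    explicit primitive of [(1 - x)^(b - 1)]. *)

Local Notation normc := ComplexField.Normc.normc.

(** * Real and imaginary parts and the modulus *)

Section complex_parts.
Context {R : realType}.
Implicit Types (x y z : R[i]) (r : R).

Lemma eqc_parts x y : complex.Re x = complex.Re y -> complex.Im x = complex.Im y -> x = y.
Proof. by case: x y => a b [c d] /= -> ->. Qed.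

Lemma cReD x y : complex.Re (x + y) = complex.Re x + complex.Re y.
Proof. by case: x y => ? ? []. Qed.
Lemma cImD x y : complex.Im (x + y) = complex.Im x + complex.Im y.
Proof. by case: x y => ? ? []. Qed.
Lemma cReN x : complex.Re (- x) = - complex.Re x. Proof. by case: x. Qed.
Lemma cImN x : complex.Im (- x) = - complex.Im x. Proof. by case: x. Qed.
Lemma cReM x y : complex.Re (x * y) =
  complex.Re x * complex.Re y - complex.Im x * complex.Im y.
Proof. by case: x y => ? ? []. Qed.
Lemma cImM x y : complex.Im (x * y) =
  complex.Re x * complex.Im y + complex.Im x * complex.Re y.
Proof. by case: x y => ? ? []. Qed.
Lemma cReZ x r : complex.Re (x * r%:C) = complex.Re x * r.
Proof. by rewrite cReM /= mulr0 subr0. Qed.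
Lemma cImZ x r : complex.Im (x * r%:C) = complex.Im x * r.
Proof. by rewrite cImM /= mulr0 add0r. Qed.

Lemma Re_sum I (s : seq I) (P : pred I) (F : I -> R[i]) :
  complex.Re (\sum_(i <- s | P i) F i) = \sum_(i <- s | P i) complex.Re (F i).
Proof. by elim/big_rec2: _ => // i a b _ <-; rewrite cReD. Qed.
Lemma Im_sum I (s : seq I) (P : pred I) (F : I -> R[i]) :
  complex.Im (\sum_(i <- s | P i) F i) = \sum_(i <- s | P i) complex.Im (F i).
Proof. by elim/big_rec2: _ => // i a b _ <-; rewrite cImD. Qed.

Lemma normc_ge0 x : 0 <= normc x.
Proof. by case: x => a b; exact: sqrtr_ge0. Qed.

Lemma normcE_C x : (normc x)%:C = `|x|.
Proof. by case: x. Qed.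

Lemma ler_normc_Re x : `|complex.Re x| <= normc x.
Proof. by have := normc_ge_Re x; rewrite -normcE_C lecR. Qed.

Lemma ler_normc_Im x : `|complex.Im x| <= normc x.
Proof.
case: x => a b /=; rewrite -sqrtr_sqr ler_wsqrtr// lerDr sqr_ge0//.
Qed.

Lemma normcD x y : normc (x + y) <= normc x + normc y.
Proof. by rewrite -lecR rmorphD /= !normcE_C ler_normD. Qed.

Lemma normcM x y : normc (x * y) = normc x * normc y.
Proof. exact: ComplexField.Normc.normcM. Qed.

Lemma normcX x n : normc (x ^+ n) = normc x ^+ n.
Proof.
elim: n => [|n IH]; last by rewrite !exprS normcM IH.
by rewrite !expr0; exact: ComplexField.Normc.normc1.
Qed.

Lemma normc_real r : normc r%:C = `|r|.
Proof. by rewrite /= expr0n addr0 sqrtr_sqr. Qed.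

Lemma normc_nat n : normc (n%:R : R[i]) = n%:R.
Proof. by rewrite -(rmorph_nat (real_complex R)) normc_real normr_nat. Qed.

Lemma normc_sum I (s : seq I) (P : pred I) (F : I -> R[i]) :
  normc (\sum_(i <- s | P i) F i) <= \sum_(i <- s | P i) normc (F i).
Proof.
elim/big_rec2: _ => [|i a b _ h]; last by rewrite (le_trans (normcD _ _))// lerD2l.
by rewrite (_ : 0 = 0%:C)// normc_real normr0.
Qed.

Lemma normc_prod I (s : seq I) (P : pred I) (F : I -> R[i]) :
  normc (\prod_(i <- s | P i) F i) = \prod_(i <- s | P i) normc (F i).
Proof.
elim/big_rec2: _ => [|i a b _ h]; first exact: ComplexField.Normc.normc1.
by rewrite normcM h.
Qed.

Lemma normc_le_parts x : normc x <= `|complex.Re x| + `|complex.Im x|.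
Proof.
rewrite -lecR normcE_C {1}(complexE x) (le_trans (ler_normD _ _))//.
rewrite normrM -!normcE_C -!rmorphM/= -rmorphD /= lecR.
by rewrite !expr0n !expr1n !addr0 !add0r !sqrtr_sqr sqrtr1 mul1r.
Qed.

End complex_parts.

(** Limits and derivatives of complex-valued functions of a real variable are
    taken on real and imaginary parts, which gives access to the real library. *)
Section componentwise_limits.
Context {R : realType}.
Implicit Types (u v : nat -> R[i]) (k l : R[i]).

Definition ccvg u l : Prop :=
  ((fun n => complex.Re (u n)) @ \oo --> complex.Re l) /\
  ((fun n => complex.Im (u n)) @ \oo --> complex.Im l).

Lemma ccvg_unique u k l : ccvg u k -> ccvg u l -> k = l.
Proof.
move=> [a b] [c d]; apply: eqc_parts.
- by rewrite -(cvg_lim (@Rhausdorff R) a) -(cvg_lim (@Rhausdorff R) c).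
- by rewrite -(cvg_lim (@Rhausdorff R) b) -(cvg_lim (@Rhausdorff R) d).
Qed.

Lemma ccvg_ext u v l : ccvg u l -> u =1 v -> ccvg v l.
Proof. by move=> ul /funext <-. Qed.

Lemma ccvg_cst k : ccvg (fun=> k) k.
Proof. by split; exact: cvg_cst. Qed.

Lemma ccvgD u v k l : ccvg u k -> ccvg v l -> ccvg (fun n => u n + v n) (k + l).
Proof.
move=> [a b] [c d]; split; rewrite ?cReD ?cImD.
- by under eq_fun do rewrite cReD; exact: cvgD.
- by under eq_fun do rewrite cImD; exact: cvgD.
Qed.

Lemma ccvgM u v k l : ccvg u k -> ccvg v l -> ccvg (fun n => u n * v n) (k * l).
Proof.
move=> [a b] [c d]; split; rewrite ?cReM ?cImM.
- by under eq_fun do rewrite cReM; apply: cvgB; exact: cvgM.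
- by under eq_fun do rewrite cImM; apply: cvgD; exact: cvgM.
Qed.

Lemma ccvgMl k u l : ccvg u l -> ccvg (fun n => k * u n) (k * l).
Proof. by apply: ccvgM; exact: ccvg_cst. Qed.

Lemma ccvg_prod (I : Type) (s : seq I) (P : pred I) (f : I -> nat -> R[i])
    (l : I -> R[i]) :
  (forall i, P i -> ccvg (f i) (l i)) ->
  ccvg (fun n => \prod_(i <- s | P i) f i n) (\prod_(i <- s | P i) l i).
Proof.
move=> h; elim: s => [|a s IH].
  by rewrite big_nil; under [X in ccvg X]eq_fun do rewrite big_nil; exact: ccvg_cst.
rewrite big_cons; under [X in ccvg X]eq_fun do rewrite big_cons.
by case: ifPn => // Pa; apply: ccvgM; first exact: h.
Qed.

Lemma ccvg_shiftS u l : ccvg (fun n => u n.+1) l <-> ccvg u l.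
Proof.
rewrite /ccvg; split=> -[a b]; split.
- by move: a; rewrite (cvg_shiftS (fun n => complex.Re (u n))).
- by move: b; rewrite (cvg_shiftS (fun n => complex.Im (u n))).
- by rewrite (cvg_shiftS (fun n => complex.Re (u n))).
- by rewrite (cvg_shiftS (fun n => complex.Im (u n))).
Qed.

(** Bridge to [hypergeometric], whose limit is taken in the norm topology; it rests on
    [|z| <= |Re z| + |Im z|]. *)
Lemma ccvg_cvg u l : ccvg u l -> (u : nat -> R[i]^o) @ \oo --> (l : R[i]^o).
Proof.
move=> [a b]; apply/cvgrPdist_lt => e e0.
(* In the order of [R[i]], positivity forces [e] to be real. *)
have [er eE er0] : exists2 r : R, e = r%:C & 0 < r.
  move: e0; rewrite ltcE => /andP[/eqP h1 h2]; exists (complex.Re e) => //.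
  by apply: eqc_parts; rewrite ?h1.
have e2 : 0 < er / 2 by rewrite divr_gt0.
move/cvgrPdist_lt : a => /(_ _ e2) a; move/cvgrPdist_lt : b => /(_ _ e2) b.
near=> n; rewrite -normcE_C eE ltcR (le_lt_trans (normc_le_parts _))//.
rewrite cReD cImD cReN cImN [ltRHS](splitr er) ltrD//; by near: n.
Unshelve. all: by end_near.
Qed.

End componentwise_limits.

(** * Coefficients of subexponential growth and their power series on []-1, 1[] *)

Section subexponential.
Context {R : realType}.
Implicit Types (c : nat -> R[i]).

(** Radius of convergence at least 1. Both the binomial and the exponential coefficients satisfy it,
    and it is stable under termwise differentiation. *)
Definition subexp c : Prop := forall s : R, 1 < s ->
  exists M : R, forall n, normc (c n) <= M * s ^+ n.

(** Ratio test. The constant, a sum of the moduli up to index [N], dominates every initial term;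
    past [N] each step costs at most one factor [s]. *)
Lemma subexp_ratio c :
  (forall s : R, 1 < s -> exists N, forall n, (N <= n)%N ->
     normc (c n.+1) <= s * normc (c n)) -> subexp c.
Proof.
move=> h s s1; have [N hN] := h s s1.
have s0 : 0 < s by apply: lt_trans s1.
exists (\sum_(i < N.+1) normc (c i)) => n.
have M0 m : (m <= N)%N -> normc (c m) <= \sum_(i < N.+1) normc (c i).
  move=> mN; rewrite (bigD1 (inord m))//= inordK// lerDl.
  by apply: sumr_ge0 => *; exact: normc_ge0.
have S0 : 0 <= \sum_(i < N.+1) normc (c i) by apply: sumr_ge0 => *; exact: normc_ge0.
elim: n => [|n IH]; first by rewrite expr0 mulr1 M0.
have [Nn|nN] := leqP N n.
  by rewrite (le_trans (hN _ Nn))// exprS mulrCA ler_pM2l.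
by rewrite (le_trans (M0 _ nN))// ler_peMr// exprn_ege1// ltW.
Qed.

Lemma subexp_le c (d : nat -> R[i]) :
  (forall n, normc (d n) <= normc (c n)) -> subexp c -> subexp d.
Proof.
move=> dc h s s1; have [M hM] := h s s1; exists M => n.
exact: le_trans (dc n) (hM n).
Qed.

(** With [s = r * r], one factor [r ^+ n] bounds the growth of [c] and the other absorbs [n + 1], by
    the Bernoulli inequality [n (r - 1) <= r ^+ n]. *)
Lemma subexp_diffs c : subexp c -> subexp (fun n => n.+1%:R * c n.+1).
Proof.
move=> h s s1; have s0 : 0 <= s by rewrite ltW// (lt_trans _ s1).
pose r := Num.sqrt s; have r1 : 1 < r by rewrite -{1}sqrtr1 ltr_sqrt// (lt_trans _ s1).
have rr : s = r * r by rewrite -expr2 sqr_sqrtr.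
have [M hM] := h r r1.
have r10 : 0 < r - 1 by rewrite subr_gt0.
have r0 : 0 < r by apply: lt_trans r1.
have nr n : n.+1%:R <= (1 + (r - 1)^-1) * r ^+ n.
  have r1n m : 1 <= r ^+ m by rewrite exprn_ege1// ltW.
  have : n%:R * (r - 1) <= r ^+ n.
    elim: n => [|n IH]; first by rewrite mul0r expr0 ler01.
    have := r1n n; rewrite -natr1 exprS.
    by move=> ?; rewrite mulrDl mul1r; nra.
  rewrite -ler_pdivlMr// mulrC => nrn.
  by rewrite -natr1 mulrDl mul1r addrC lerD.
exists ((1 + (r - 1)^-1) * (M * r)) => n.
rewrite normcM normc_nat rr exprMn.
have -> : (1 + (r - 1)^-1) * (M * r) * (r ^+ n * r ^+ n) =
   ((1 + (r - 1)^-1) * r ^+ n) * (M * r ^+ n.+1) by rewrite exprS; ring.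
by rewrite ler_pM// normc_ge0.
Qed.

Lemma subexp_sum_bound c (x : R) : subexp c -> 0 <= x < 1 ->
  exists B, forall N, \sum_(n < N) normc (c n) * x ^+ n <= B.
Proof.
move=> h /andP[x0 x1].
have [s s1 sx] : exists2 s : R, 1 < s & s * x < 1.
  (* Both [1 < s] and [s * x < 1] then amount to [x < 1], and the sum is compared with a geometric
     series of ratio [s * x]. *)
  exists (2 / (1 + x)); first by rewrite ltr_pdivlMr; lra.
  by rewrite mulrAC ltr_pdivrMr; lra.
have s0 : 0 < s by apply: lt_trans s1.
have [M hM] := h s s1; exists (M / (1 - s * x)) => N.
have M0 : 0 <= M by have := hM 0; rewrite expr0 mulr1; exact/le_trans/normc_ge0.
apply: (@le_trans _ _ (\sum_(n < N) M * (s * x) ^+ n)).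
  apply: ler_sum => i _; rewrite exprMn mulrA ler_wpM2r// exprn_ge0//.
rewrite -mulr_sumr ler_wpM2l//.
have sx1 : 0 < 1 - s * x by rewrite subr_gt0.
rewrite -div1r ler_pdivlMr// mulrC -opprB mulNr -subrX1 opprB gerBl.
by rewrite exprn_ge0// mulr_ge0// ltW.
Qed.

(** The variable is real, so that termwise differentiation of real power series applies to each
    part. A complex argument [w * x] is treated by moving [w ^+ n] into the coefficients. *)
Definition csum c (x : R) : R[i] :=
  limn (pseries (fun n => complex.Re (c n)) x) +i*
  limn (pseries (fun n => complex.Im (c n)) x).

Lemma is_cvg_pseries_subexp c (f : R ^nat) (x : R) : subexp c ->
  (forall n, `|f n| <= normc (c n)) -> `|x| < 1 -> cvgn (pseries f x).
Proof.
move=> sc fc x1; apply: normed_cvg => /=.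
have [B hB] := @subexp_sum_bound c `|x| sc (introT andP (conj (normr_ge0 x) x1)).
apply: nondecreasing_is_cvgn.
  by apply: nondecreasing_series => n _ _; exact: normr_ge0.
exists B => _ [n _ <-]; apply: le_trans (hB n).
rewrite [leLHS](_ : _ = \sum_(i < n) `|f i * x ^+ i|); last first.
  by rewrite /normed_series_of /series /= big_mkord.
apply: ler_sum => i _.
by rewrite normrM normrX ler_wpM2r// exprn_ge0.
Qed.

Lemma csum_cvg c (x : R) : subexp c -> `|x| < 1 ->
  ccvg (fun N => \sum_(n < N) c n * x%:C ^+ n) (csum c x).
Proof.
move=> sc x1; split.
- rewrite [X in X @ _ --> _](_ : _ = pseries (fun n => complex.Re (c n)) x).
    exact: is_cvg_pseries_subexp sc (fun n => ler_normc_Re (c n)) x1.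
  apply/funext => N; rewrite Re_sum /pseries /series /= big_mkord.
  by apply: eq_bigr => n _; rewrite -rmorphXn cReZ.
- rewrite [X in X @ _ --> _](_ : _ = pseries (fun n => complex.Im (c n)) x).
    exact: is_cvg_pseries_subexp sc (fun n => ler_normc_Im (c n)) x1.
  apply/funext => N; rewrite Im_sum /pseries /series /= big_mkord.
  by apply: eq_bigr => n _; rewrite -rmorphXn cImZ.
Qed.

End subexponential.

(** * Derivatives of complex-valued functions and the equation [S' = l S] *)

Section componentwise_derivative.
Context {R : realType}.
Implicit Types (f g : R -> R[i]) (x : R) (k l : R[i]).

Definition cderive f x l : Prop :=
  is_derive x 1 (fun r => complex.Re (f r)) (complex.Re l) /\
  is_derive x 1 (fun r => complex.Im (f r)) (complex.Im l).

Lemma cderiveM f g x k l : cderive f x k -> cderive g x l ->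
  cderive (fun r => f r * g r) x (k * g x + f x * l).
Proof.
move=> [a b] [c d]; split.
- under eq_fun do rewrite cReM.
  apply: is_derive_eq (is_deriveB (is_deriveM a c) (is_deriveM b d)) _.
  by rewrite cReD !cReM /GRing.scale/=; ring.
- under eq_fun do rewrite cImM.
  apply: is_derive_eq (is_deriveD (is_deriveM a d) (is_deriveM b c)) _.
  by rewrite cImD !cImM /GRing.scale/=; ring.
Qed.

Lemma cderive_eq f x k l : cderive f x k -> k = l -> cderive f x l.
Proof. by move=> h <-. Qed.

Lemma cderiveMl f k x l : cderive f x l -> cderive (fun r => k * f r) x (k * l).
Proof.
move=> h; have hk : cderive (fun=> k) x 0 by split; exact: is_derive_cst.
by apply: cderive_eq (cderiveM _ _ _ _ _ hk h) _; rewrite mul0r add0r.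
Qed.

Lemma cderive_cexp f x l : cderive f x l ->
  cderive (fun r => cexp (f r)) x (l * cexp (f x)).
Proof.
move=> [a b]; split.
- have -> : (fun r => complex.Re (cexp (f r))) =
      (expR \o (fun r => complex.Re (f r))) * (cos \o (fun r => complex.Im (f r))).
    by apply/funext => r; rewrite /cexp cReM /= mul0r subr0.
  by apply: is_derive_eq; rewrite /cexp !(cReM, cImM) /GRing.scale/=; ring.
- have -> : (fun r => complex.Im (cexp (f r))) =
      (expR \o (fun r => complex.Re (f r))) * (sin \o (fun r => complex.Im (f r))).
    by apply/funext => r; rewrite /cexp cImM /= mul0r addr0.
  by apply: is_derive_eq; rewrite /cexp !(cReM, cImM) /GRing.scale/=; ring.
Qed.

Lemma is_derive0_cst_itv (f : R -> R) x : `|x| < 1 ->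
  (forall y : R, `|y| < 1 -> is_derive y 1 f 0) -> f x = f 0.
Proof.
move=> x1 df.
have cst (a b : R) : a <= b -> `|a| < 1 -> `|b| < 1 -> f b = f a.
  move=> ab a1 b1.
  have [||c _] := @MVT_segment _ f (fun=> 0) _ _ ab.
  - move=> y /[!in_itv]/= /andP[ay yb]; apply: df.
    by move: a1 b1; rewrite !ltr_norml; lra.
  - apply: derivable_within_continuous => y /[!in_itv]/= /andP[ay yb].
    suff /df[] : `|y| < 1 by [].
    by move: a1 b1; rewrite !ltr_norml; lra.
  - by rewrite mul0r => /eqP; rewrite subr_eq0 => /eqP.
by have [x0|/ltW x0] := leP 0 x; [apply: cst|apply/esym/cst]; rewrite ?normr0.
Qed.

Lemma cexpD k l : cexp (k + l) = cexp k * cexp l.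
Proof.
apply: eqc_parts; rewrite /cexp !(cReM, cImM, cReD, cImD) /= expRD ?cosD ?sinD; ring.
Qed.

Lemma cexp0 : cexp (0 : R[i]) = 1.
Proof. by rewrite /cexp /= expR0 cos0 sin0 mul1r. Qed.

(* The derivative of [S exp(-L)] is zero. *)
Lemma ode_cexp (S L l : R -> R[i]) x : `|x| < 1 ->
  (forall y, `|y| < 1 -> cderive S y (l y * S y)) ->
  (forall y, `|y| < 1 -> cderive L y (l y)) ->
  S 0 = cexp (L 0) -> S x = cexp (L x).
Proof.
move=> x1 dS dL S0.
pose H r := S r * cexp (-1 * L r).
have dH y : `|y| < 1 -> cderive H y 0.
  move=> y1; apply: cderive_eq.
    exact: cderiveM (dS _ y1) (cderive_cexp _ _ _ (cderiveMl _ (-1) _ _ (dL _ y1))).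
  by cbv beta; ring.
have HK z : H z = 1 -> S z = cexp (L z).
  by move=> Hz; rewrite -[RHS]mul1r -Hz /H -mulrA -cexpD mulN1r addNr cexp0 mulr1.
have H0 : H 0 = 1 by rewrite /H S0 -cexpD mulN1r addrN cexp0.
apply: HK; rewrite -H0; apply: eqc_parts.
- by apply: (is_derive0_cst_itv (fun r => complex.Re (H r))) => // y /dH[].
- by apply: (is_derive0_cst_itv (fun r => complex.Im (H r))) => // y /dH[].
Qed.

Lemma cderive_csum (c : nat -> R[i]) x : subexp c -> `|x| < 1 ->
  cderive (csum c) x (csum (fun n => n.+1%:R * c n.+1) x).
Proof.
move=> sc x1.
(* [pseries_snd_diffs] asks for convergence of the series and of its first two formal derivatives at
   a point farther out than [x]; the midpoint between [|x|] and 1 is taken. *)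
have [K xK K1] : exists2 K : R, `|x| < `|K| & `|K| < 1.
  by exists ((`|x| + 1) / 2); rewrite [`|_ / 2|]ger0_norm; have := normr_ge0 x; lra.
have dRe : (fun n => complex.Re (n.+1%:R * c n.+1)) =
     pseries_diffs (fun n => complex.Re (c n)).
  by apply/funext => n; rewrite -(rmorph_nat (real_complex R)) mulrC cReZ mulrC.
have dIm : (fun n => complex.Im (n.+1%:R * c n.+1)) =
     pseries_diffs (fun n => complex.Im (c n)).
  by apply/funext => n; rewrite -(rmorph_nat (real_complex R)) mulrC cImZ mulrC.
have sd := subexp_diffs _ sc.
have sdd := subexp_diffs _ sd.
split => /=; rewrite ?dRe ?dIm; apply: (@pseries_snd_diffs _ _ K) => //.
- exact: is_cvg_pseries_subexp sc (fun n => ler_normc_Re (c n)) K1.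
- rewrite -dRe; exact: is_cvg_pseries_subexp sd (fun n => ler_normc_Re _) K1.
- rewrite -dRe (_ : pseries_diffs _ = (fun n => complex.Re (n.+1%:R * (n.+2%:R * c n.+2)))).
    exact: is_cvg_pseries_subexp sdd (fun n => ler_normc_Re _) K1.
  by apply/funext => n; rewrite -[n.+1%:R](rmorph_nat (real_complex R)) [in RHS]mulrC cReZ mulrC.
- exact: is_cvg_pseries_subexp sc (fun n => ler_normc_Im (c n)) K1.
- rewrite -dIm; exact: is_cvg_pseries_subexp sd (fun n => ler_normc_Im _) K1.
- rewrite -dIm (_ : pseries_diffs _ = (fun n => complex.Im (n.+1%:R * (n.+2%:R * c n.+2)))).
    exact: is_cvg_pseries_subexp sdd (fun n => ler_normc_Im _) K1.
  by apply/funext => n; rewrite -[n.+1%:R](rmorph_nat (real_complex R)) [in RHS]mulrC cImZ mulrC.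
Qed.

End componentwise_derivative.

(** * The exponential series and the binomial series on the unit disc *)

Section exponential_and_binomial_series.
Context {R : realType}.
Implicit Types (a v w z : R[i]) (r : R).

(* [cln] on the half-plane [Re z > 0], in a form without the case distinction and
   the singularities of [acos]. *)
Let clog z : R[i] :=
  (ln (complex.Re z ^+ 2 + complex.Im z ^+ 2) / 2) +i*
  atan (complex.Im z / complex.Re z).

(** For [x > 0], [x / |z|] is the cosine of [atan (y / x)]. Hence [acos] returns the absolute value
    of that angle, and the case distinction of [carg] on the sign of [y] restores its sign. *)
Let cln_clog z : 0 < complex.Re z -> cln z = clog z.
Proof.
case: z => x y /= x0.
have x2y2 : 0 < x ^+ 2 + y ^+ 2 by rewrite ltr_wpDr ?sqr_ge0 ?exprn_gt0.
rewrite /cln /clog /=; congr (_ +i* _).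
  by rewrite -powR12_sqrt ?ln_powR ?ltW// mulrC.
rewrite /carg /=.
have -> : x / Num.sqrt (x ^+ 2 + y ^+ 2) = cos (atan (y / x)).
  rewrite cos_atan; have -> : 1 + (y / x) ^+ 2 = (x ^+ 2 + y ^+ 2) / x ^+ 2.
    by field; rewrite gt_eqF.
  by rewrite sqrtrM ?ltW// sqrtrV ?sqr_ge0// sqrtr_sqr gtr0_norm// invfM invrK mulrC.
have := atan_gtNpi2 (y / x); have := atan_ltpi2 (y / x); have := pi_gt0 R.
case: ifPn => [y0|]; last rewrite -ltNge => y0.
  have : 0 <= atan (y / x) by rewrite -[leLHS]atan0; apply: le_atan; rewrite divr_ge0// ltW.
  by move=> *; rewrite cosK// in_itv/=; lra.
have : atan (y / x) < 0 by rewrite -[ltRHS]atan0; apply: lt_atan; rewrite pmulr_llt0 ?invr_gt0.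
by move=> *; rewrite cosKN ?opprK//; lra.
Qed.

Let cderive_clog (f : R -> R[i]) r l : 0 < complex.Re (f r) -> cderive f r l ->
  cderive (fun x => clog (f x)) r (l / f r).
Proof.
move=> f0 [a b].
pose x := complex.Re (f r); pose y := complex.Im (f r).
have x2y2 : 0 < x ^+ 2 + y ^+ 2 by rewrite ltr_wpDr ?sqr_ge0 ?exprn_gt0.
have fV : (f r)^-1 = (x / (x ^+ 2 + y ^+ 2)) +i* (- (y / (x ^+ 2 + y ^+ 2))).
  by rewrite /x /y; case: (f r).
split.
- pose g r := complex.Re (f r) ^+ 2 + complex.Im (f r) ^+ 2.
  have dg : is_derive r 1 g (2 * x * complex.Re l + 2 * y * complex.Im l).
    apply: is_derive_eq (is_deriveD (is_deriveM a a) (is_deriveM b b)) _.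
    by rewrite /GRing.scale/= /x /y; ring.
  have dl := is_derive1_ln x2y2.
  rewrite (_ : (fun _ => _) = 2^-1 *: (@ln R \o g)); last first.
    by apply/funext => z; rewrite /= /GRing.scale/= mulrC.
  have dlg := @is_derive1_comp R (@ln R) g r _ _ dl dg.
  apply: is_derive_eq; rewrite fV cReM /= /GRing.scale/=.
  by field; rewrite gt_eqF.
- have h0 : x != 0 by rewrite gt_eqF.
  have dV := @is_deriveV R (fun r => complex.Re (f r)) r _ 1 h0 a.
  pose g r := complex.Im (f r) / complex.Re (f r).
  have dg : is_derive r 1 g ((complex.Im l * x - y * complex.Re l) / x ^+ 2).
    rewrite /g (_ : (fun r0 => _) = (fun r => complex.Im (f r)) *
       (fun r => (complex.Re (f r))^-1)); last by apply/funext.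
    by apply: is_derive_eq; rewrite /GRing.scale/= /x /y; field.
  rewrite (_ : (fun _ => _) = @atan R \o g); last by [].
  have da := is_derive1_atan (g r).
  have dag := @is_derive1_comp R (@atan R) g r _ _ da dg.
  apply: is_derive_eq; rewrite fV cImM /= /g -/x -/y.
  by field; rewrite h0 gt_eqF//= gt_eqF.
Qed.

Lemma pochhammerS a n : pochhammer a n.+1 = pochhammer a n * (a + n%:R).
Proof. by rewrite /pochhammer big_ord_recr. Qed.

Lemma subexp_binomial a : subexp (fun n => pochhammer a n / n`!%:R).
Proof.
apply: subexp_ratio => s s1.
have s10 : 0 < s - 1 by rewrite subr_gt0.
(* The ratio of consecutive terms is [(a + n) / (n + 1)]; its modulus is at most [s] once
   [|a| <= n (s - 1)]. *)
have [N hN] : exists N : nat, normc a / (s - 1) <= N%:R.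
  exists (Num.bound (normc a / (s - 1))); apply/ltW.
  by apply: archi_boundP; rewrite divr_ge0 ?normc_ge0// ltW.
exists N => n Nn.
rewrite pochhammerS factS natrM invfM.
rewrite [X in normc X](_ : _ = (a + n%:R) / n.+1%:R * (pochhammer a n / n`!%:R)); last by ring.
rewrite normcM ler_wpM2r ?normc_ge0// normcM ComplexField.Normc.normcV normc_nat.
rewrite ler_pdivrMr// (le_trans (normcD _ _))// normc_nat -natr1.
have : normc a <= n%:R * (s - 1).
  by rewrite -ler_pdivrMr// (le_trans hN)// ler_nat.
have : (0:R) <= n%:R by [].
by lra.
Qed.

Lemma subexp_exponential v : subexp (fun n => v ^+ n / n`!%:R).
Proof.
apply: subexp_ratio => s s1; exists (Num.bound (normc v)) => n Nn.
rewrite exprS factS natrM invfM.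
rewrite [X in normc X](_ : _ = v / n.+1%:R * (v ^+ n / n`!%:R)); last by ring.
rewrite normcM ler_wpM2r ?normc_ge0// normcM ComplexField.Normc.normcV normc_nat.
rewrite ler_pdivrMr//.
have vn : normc v <= n.+1%:R.
  apply/ltW; apply: lt_le_trans (archi_boundP (normc_ge0 v)) _.
  by rewrite ler_nat leqW.
by rewrite (le_trans vn)// ler_peMl// ltW.
Qed.

Let subexp_rotate (c : nat -> R[i]) w : normc w <= 1 -> subexp c ->
  subexp (fun n => c n * w ^+ n).
Proof.
move=> w1; apply: subexp_le => n.
by rewrite normcM normcX ler_piMr ?normc_ge0// exprn_ile1 ?normc_ge0.
Qed.

Let csum0 (c : nat -> R[i]) : subexp c -> csum c 0 = c 0%N.
Proof.
move=> sc; apply: (ccvg_unique _ _ _ (csum_cvg _ 0 sc _)); first by rewrite normr0.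
apply/ccvg_shiftS; under [X in ccvg X]eq_fun => N.
  rewrite big_ord_recl big1 => [|i _]; last by rewrite expr0n /= mulr0.
  rewrite expr0 mulr1 addr0; over.
exact: ccvg_cst.
Qed.

Let cderive_affine k z r : cderive (fun x : R => k + z * x%:C) r z.
Proof.
split.
- rewrite (_ : (fun _ => _) = (fun x => complex.Re k + complex.Re z * x)); last first.
    by apply/funext => x; rewrite cReD cReZ.
  by apply: is_derive_eq; rewrite add0r mul1r [_%:A]mulr1.
- rewrite (_ : (fun _ => _) = (fun x => complex.Im k + complex.Im z * x)); last first.
    by apply/funext => x; rewrite cImD cImZ.
  by apply: is_derive_eq; rewrite add0r mul1r [_%:A]mulr1.
Qed.

Let csum_cvg_rotate (c : nat -> R[i]) w r : normc w <= 1 -> `|r| < 1 -> subexp c ->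
  ccvg (fun N => \sum_(n < N) c n * (w * r%:C) ^+ n) (csum (fun n => c n * w ^+ n) r).
Proof.
move=> w1 r1 sc; have := csum_cvg _ _ (subexp_rotate _ _ w1 sc) r1.
by under [in X in ccvg X]eq_fun do under eq_bigr do rewrite -mulrA -exprMn.
Qed.

(** As functions of [r], both sides satisfy [S' = v w S] and equal 1 at 0. *)
Lemma cexp_series v w r : normc w <= 1 -> `|r| < 1 ->
  ccvg (fun N => \sum_(n < N) v ^+ n / n`!%:R * (w * r%:C) ^+ n)
       (cexp (v * (w * r%:C))).
Proof.
move=> w1 r1; have sc := subexp_exponential v.
have sr := subexp_rotate _ _ w1 sc.
(* The summand [0] gives the exponent the shape differentiated by [cderive_affine]. *)
have -> : v * (w * r%:C) = 0 + v * w * r%:C by ring.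
rewrite -(ode_cexp (csum (fun n => v ^+ n / n`!%:R * w ^+ n))
   (fun x => 0 + v * w * x%:C) (fun=> v * w))//.
- exact: csum_cvg_rotate.
- move=> y y1; apply: cderive_eq; first exact: cderive_csum.
  apply: ccvg_unique (csum_cvg _ _ (subexp_diffs _ sr) y1) _.
  apply: ccvg_ext (ccvgMl (v * w) _ _ (csum_cvg _ _ sr y1)) _ => N.
  rewrite mulr_sumr; apply: eq_bigr => n _.
  rewrite mulrA; congr (_ * _); rewrite factS natrM !exprS; field.
  by rewrite nat1r !pnatr_eq0 -lt0n fact_gt0.
- by rewrite csum0// mulr0 addr0 cexp0 !expr0 fact0 divr1 mulr1.
Qed.

(** As functions of [r], both sides satisfy [S' = a w / (1 - w r) S] and equal 1 at 0. Since
    [|w r| < 1], the point [1 - w r] stays in the half-plane of positive real part, where the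
    principal logarithm is the smooth [clog]. *)
Lemma cpow_series a w r : normc w <= 1 -> `|r| < 1 ->
  ccvg (fun N => \sum_(n < N) pochhammer a n / n`!%:R * (w * r%:C) ^+ n)
       (cpow (1 - w * r%:C) (- a)).
Proof.
move=> w1 r1; have sc := subexp_binomial a.
have sr := subexp_rotate _ _ w1 sc.
have Re0 (y : R) : `|y| < 1 -> 0 < complex.Re (1 - w * y%:C).
  move=> y1; rewrite cReD cReN cReZ /= subr_gt0.
  rewrite (le_lt_trans (ler_norm _))// normrM.
  by rewrite (le_lt_trans _ y1)// ler_piMl// (le_trans (ler_normc_Re _)).
have -> : cpow (1 - w * r%:C) (- a) = cexp (- a * clog (1 - w * r%:C)).
  rewrite /cpow -cln_clog ?Re0// ifF//; apply/eqP => h.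
  by have := Re0 r r1; rewrite h ltxx.
rewrite -(ode_cexp (csum (fun n => pochhammer a n / n`!%:R * w ^+ n))
   (fun x => - a * clog (1 - w * x%:C)) (fun x => a * w / (1 - w * x%:C)))//.
- exact: csum_cvg_rotate.
- move=> y y1; apply: cderive_eq; first exact: cderive_csum.
  set d := fun n => _.
  have sd : subexp d := subexp_diffs _ sr.
  (* The termwise form of [(1 - w y) S'(y) = a w S(y)]. *)
  have dE n : d n = (a + n%:R) * w * (pochhammer a n / n`!%:R * w ^+ n).
    rewrite /d pochhammerS factS natrM exprS; field.
    by rewrite nat1r !pnatr_eq0 -lt0n fact_gt0.
  have nz : 1 - w * y%:C != 0.
    by apply/eqP => h; have := Re0 y y1; rewrite h ltxx.
  have dS := csum_cvg _ _ sd y1; have S := csum_cvg _ _ sr y1.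
  have key : csum d y = a * w * csum (fun n => pochhammer a n / n`!%:R * w ^+ n) y
      + w * y%:C * csum d y.
    (* Multiplication by [y] shifts the index, so partial sums of length [N.+1] of [S'] and [S] are
       matched with those of length [N] of [w y S']. *)
    apply: ccvg_unique ((ccvg_shiftS _ _).2 dS) _.
    apply: ccvg_ext (ccvgD _ _ _ _ (ccvgMl (a * w) _ _ ((ccvg_shiftS _ _).2 S))
       (ccvgMl (w * y%:C) _ _ dS)) _ => N; rewrite 2!mulr_sumr.
    rewrite big_ord_recl [in RHS]big_ord_recl -addrA -big_split/=.
    congr (_ + _); first by rewrite dE addr0; ring.
    apply: eq_bigr => n _; rewrite [in RHS]dE /d /bump /= add1n !exprS; ring.
  apply: (mulfI nz); rewrite mulrBl mul1r {1}key; field.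
  done.
- move=> y y1; apply: cderive_eq.
    apply: cderiveMl; apply: cderive_clog; first exact: Re0.
    rewrite (_ : (fun _ => _) = (fun x => 1 + (- w) * x%:C)); first exact: cderive_affine.
    by apply/funext => x; rewrite mulNr.
  by ring.
- rewrite csum0// mulr0 subr0 /pochhammer big_ord0 expr0 fact0 divr1 mulr1.
  rewrite /clog /= expr1n expr0n addr0 ln1 !mul0r atan0.
  by rewrite (_ : 0 +i* 0 = 0)// mulr0 cexp0.
Qed.

End exponential_and_binomial_series.

(** * Linearity, restriction and dominated convergence for [cintegral] *)

Section complex_integral_theory.
Context {d} {T : measurableType d} {R : realType}.
Variable mu : {measure set T -> \bar R}.
Implicit Types (D : set T) (f g : T -> R[i]).

Lemma eq_cintegral D f g : (forall x, D x -> f x = g x) ->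
  cintegral mu D f = cintegral mu D g.
Proof.
move=> fg; rewrite /cintegral; congr (_ +i* _);
  by apply: eq_Rintegral => x /[1!inE] Dx; rewrite fg.
Qed.

Lemma eq_cintegrable D f g : measurable D -> (forall x, D x -> f x = g x) ->
  cintegrable mu D f -> cintegrable mu D g.
Proof.
move=> mD fg [a b]; split.
- by apply: eq_integrable a => // x /[1!inE] Dx; rewrite fg.
- by apply: eq_integrable b => // x /[1!inE] Dx; rewrite fg.
Qed.

Lemma cintegrableMl D k f : measurable D -> cintegrable mu D f ->
  cintegrable mu D (fun x => k * f x).
Proof.
move=> mD [a b]; split.
- rewrite (_ : (fun _ => _) = (fun x => (complex.Re k)%:E * (complex.Re (f x))%:E)
     \- (fun x => (complex.Im k)%:E * (complex.Im (f x))%:E))%E.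
    by apply: integrableB => //; exact: integrableZl.
  by apply/funext => x; rewrite cReM.
- rewrite (_ : (fun _ => _) = (fun x => (complex.Re k)%:E * (complex.Im (f x))%:E)
     \+ (fun x => (complex.Im k)%:E * (complex.Re (f x))%:E))%E.
    by apply: integrableD => //; exact: integrableZl.
  by apply/funext => x; rewrite cImM.
Qed.

Lemma cintegralMl D k f : measurable D -> cintegrable mu D f ->
  cintegral mu D (fun x => k * f x) = k * cintegral mu D f.
Proof.
move=> mD [a b]; have Zl r (u : T -> R) : mu.-integrable D (fun x => (u x)%:E) ->
    mu.-integrable D (EFin \o (fun x => r * u x)) by exact: integrableZl.
apply: eqc_parts; rewrite ?cReM ?cImM /= -?RintegralZl//.
- rewrite -RintegralB//; [|exact: Zl..].
  by apply: eq_Rintegral => x _; rewrite cReM.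
- rewrite -RintegralD//; [|exact: Zl..].
  by apply: eq_Rintegral => x _; rewrite cImM.
Qed.

Lemma cintegrable_sum I (s : seq I) D (F : I -> T -> R[i]) : measurable D ->
  (forall i, cintegrable mu D (F i)) ->
  cintegrable mu D (fun x => \sum_(i <- s) F i x).
Proof.
move=> mD iF; split.
- rewrite (_ : (fun _ => _) = (fun x => \sum_(i <- s) (complex.Re (F i x))%:E)%E).
    by apply: integrable_sum => // i _; case: (iF i).
  by apply/funext => x; rewrite Re_sum sumEFin.
- rewrite (_ : (fun _ => _) = (fun x => \sum_(i <- s) (complex.Im (F i x))%:E)%E).
    by apply: integrable_sum => // i _; case: (iF i).
  by apply/funext => x; rewrite Im_sum sumEFin.
Qed.

Lemma cintegral_sum I (s : seq I) D (F : I -> T -> R[i]) : measurable D ->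
  (forall i, cintegrable mu D (F i)) ->
  cintegral mu D (fun x => \sum_(i <- s) F i x) = \sum_(i <- s) cintegral mu D (F i).
Proof.
move=> mD iF; elim: s => [|i s IH].
  rewrite big_nil (eq_cintegral _ _ (fun=> 0)) => [|x _]; last by rewrite big_nil.
  by rewrite /cintegral Rintegral_cst// mul0r.
rewrite big_cons -IH (eq_cintegral _ _ (fun x => F i x + \sum_(j <- s) F j x)).
  have [a b] := iF i; have [c e] := cintegrable_sum _ s _ _ mD iF.
  apply: eqc_parts; rewrite ?cReD ?cImD /= -RintegralD//.
  - by apply: eq_Rintegral => x _; rewrite cReD.
  - by apply: eq_Rintegral => x _; rewrite cImD.
by move=> x _; rewrite big_cons.
Qed.

Lemma cintegrable_cst D k : measurable D -> (mu D < +oo)%E ->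
  cintegrable mu D (fun=> k).
Proof.
by move=> mD Doo; split; apply/integrableP; split => //=;
  rewrite integral_cst//= lte_mul_pinfty.
Qed.

Let cintegral_indicE D (u : T -> R) : u \_ D = (fun x => u x * \1_D x).
Proof.
by apply/funext => x; rewrite patchE indicE; case: ifP; rewrite ?mulr1 ?mulr0.
Qed.

Lemma cintegrable_mkcond D f : measurable D ->
  cintegrable mu D f <-> cintegrable mu setT (fun x => f x * (\1_D x)%:C).
Proof.
move=> mD.
have real_case (u : T -> R) : mu.-integrable D (EFin \o u) <->
    mu.-integrable setT (fun x => (u x * \1_D x)%:E).
  rewrite (integrable_mkcond _ mD) restrict_EFin.
  by rewrite (_ : EFin \o _ = (fun x => (u x * \1_D x)%:E))// cintegral_indicE.
have [a b] := real_case (fun x => complex.Re (f x)).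
have [a' b'] := real_case (fun x => complex.Im (f x)).
rewrite /cintegrable; under [in X in _ <-> X]eq_fun do rewrite cReZ.
by under [in X in _ <-> _ /\ X]eq_fun do rewrite cImZ; split=> -[]; auto.
Qed.

Lemma cintegral_mkcond D f :
  cintegral mu D f = cintegral mu setT (fun x => f x * (\1_D x)%:C).
Proof.
rewrite /cintegral Rintegral_mkcond (Rintegral_mkcond _ _ (fun x => complex.Im _)).
rewrite !cintegral_indicE.
by congr (_ +i* _); apply: eq_Rintegral => x _; rewrite ?cReZ ?cImZ.
Qed.

Lemma cintegral_dominated D (F : nat -> T -> R[i]) f (g : T -> R) :
  measurable D ->
  (forall n, cintegrable mu D (F n)) ->
  (forall x, D x -> ccvg (F ^~ x) (f x)) ->
  mu.-integrable D (EFin \o g) ->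
  (forall n x, D x -> normc (F n x) <= g x) ->
  cintegrable mu D f /\ ccvg (fun n => cintegral mu D (F n)) (cintegral mu D f).
Proof.
move=> mD iF Ff ig Fg.
have real_case (U : nat -> T -> R) (u : T -> R) :
    (forall n, mu.-integrable D (EFin \o U n)) ->
    (forall x, D x -> U ^~ x @ \oo --> u x) ->
    (forall n x, D x -> `|U n x| <= g x) ->
    mu.-integrable D (EFin \o u) /\
    (\int[mu]_(x in D) U n x)%R @[n --> \oo] --> (\int[mu]_(x in D) u x)%R.
  move=> iU Uu Ug.
  have mu_ n : measurable_fun D (U n) by apply/measurable_EFinP/measurable_int/iU.
  have mu' : measurable_fun D u by exact: measurable_fun_cvg mu_ Uu.
  have [|||||iu _ cu] := @dominated_convergence _ _ _ mu D mD
      (fun n => EFin \o U n) (EFin \o u) (EFin \o g).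
  - by move=> n; exact/measurable_EFinP.
  - exact/measurable_EFinP.
  - by apply: aeW => x Dx /=; apply/fine_cvgP; split; [exact: nearW|exact: Uu].
  - exact: ig.
  - by apply: aeW => x n Dx; rewrite /= lee_fin Ug.
  split => //; apply: fine_cvg.
  by rewrite fineK//; exact: integrable_fin_num.
have [iR cR] := real_case (fun n x => complex.Re (F n x)) (fun x => complex.Re (f x))
  (fun n => (iF n).1) (fun x Dx => (Ff x Dx).1)
  (fun n x Dx => le_trans (ler_normc_Re _) (Fg n x Dx)).
have [iI cI] := real_case (fun n x => complex.Im (F n x)) (fun x => complex.Im (f x))
  (fun n => (iF n).2) (fun x Dx => (Ff x Dx).2)
  (fun n x Dx => le_trans (ler_normc_Im _) (Fg n x Dx)).
by [].
Qed.

End complex_integral_theory.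

(** * Fubini for products of functions of separate variables *)

Section product_integral.
Context {d1 d2} {T1 : measurableType d1} {T2 : measurableType d2} {R : realType}.
Variable m1 : {sigma_finite_measure set T1 -> \bar R}.
Variable m2 : {sigma_finite_measure set T2 -> \bar R}.

(** Tonelli: the iterated integral of [|u x| |v y|] factors into two finite integrals. *)
Let integrable_prod (u : T1 -> R) (v : T2 -> R) :
  m1.-integrable setT (EFin \o u) -> m2.-integrable setT (EFin \o v) ->
  (m1 \x m2)%E.-integrable setT (fun z => (u z.1 * v z.2)%:E).
Proof.
move=> iu iv.
have mu_ : measurable_fun setT u by apply/measurable_EFinP/measurable_int/iu.
have mv_ : measurable_fun setT v by apply/measurable_EFinP/measurable_int/iv.
apply/integrable12ltyP.
  apply/measurable_EFinP; apply: measurable_funM;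
    [exact: measurableT_comp mu_ measurable_fst|exact: measurableT_comp mv_ measurable_snd].
have /integrableP[_ voo] := iv; have /integrableP[_ uoo] := iu.
have mnv : measurable_fun setT (fun y => (`|v y|)%:E).
  by apply/measurable_EFinP; exact: measurableT_comp.
have mnu : measurable_fun setT (fun x => (`|u x|)%:E).
  by apply/measurable_EFinP; exact: measurableT_comp.
have vfin : (\int[m2]_y `|(v y)%:E|)%E \is a fin_num.
  by rewrite ge0_fin_numE// integral_ge0.
under eq_integral => x _.
  under eq_integral => y _ do rewrite /= normrM EFinM.
  rewrite ge0_integralZl// -(fineK vfin); over.
have v0 : (0 <= (fine (\int[m2]_y `|(v y)%:E|))%:E)%E.
  by rewrite lee_fin fine_ge0// integral_ge0.
rewrite ge0_integralZr// lte_mul_pinfty ?ltry ?integral_ge0//.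
by rewrite ge0_fin_numE ?integral_ge0.
Qed.

Let Rintegral_prod (u : T1 -> R) (v : T2 -> R) :
  m1.-integrable setT (EFin \o u) -> m2.-integrable setT (EFin \o v) ->
  \int[(m1 \x m2)%E]_z (u z.1 * v z.2) = \int[m1]_x u x * \int[m2]_y v y.
Proof.
move=> iu iv; rewrite /Rintegral -integral12_prod_meas1; last exact: integrable_prod.
rewrite /fubini_F -fineM; [|exact: integrable_fin_num..].
congr fine; rewrite -[X in (_ * X)%E](fineK (integrable_fin_num measurableT iv)).
rewrite -integralZr//; apply: eq_integral => x _.
by rewrite (fineK (integrable_fin_num measurableT iv)) -integralZl.
Qed.

Lemma cintegrable_prod (f : T1 -> R[i]) (g : T2 -> R[i]) :
  cintegrable m1 setT f -> cintegrable m2 setT g ->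
  cintegrable (m1 \x m2)%E setT (fun z => f z.1 * g z.2).
Proof.
have iP u v : m1.-integrable setT (fun x => (u x)%:E) ->
   m2.-integrable setT (fun y => (v y)%:E) ->
   (m1 \x m2)%E.-integrable setT (fun z => (u z.1 * v z.2)%:E) by exact: integrable_prod.
move=> [a b] [c e]; split.
- rewrite (_ : (fun _ => _) = (fun z => (complex.Re (f z.1) * complex.Re (g z.2))%:E)
    \- (fun z => (complex.Im (f z.1) * complex.Im (g z.2))%:E))%E.
    have i1 := iP _ _ a c. have i2 := iP _ _ b e. exact: integrableB.
  by apply/funext => z; rewrite cReM.
- rewrite (_ : (fun _ => _) = (fun z => (complex.Re (f z.1) * complex.Im (g z.2))%:E)
    \+ (fun z => (complex.Im (f z.1) * complex.Re (g z.2))%:E))%E.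
    have i1 := iP _ _ a e. have i2 := iP _ _ b c. exact: integrableD.
  by apply/funext => z; rewrite cImM.
Qed.

Lemma cintegral_prod (f : T1 -> R[i]) (g : T2 -> R[i]) :
  cintegrable m1 setT f -> cintegrable m2 setT g ->
  cintegral (m1 \x m2)%E setT (fun z => f z.1 * g z.2) =
  cintegral m1 setT f * cintegral m2 setT g.
Proof.
have iP u v : m1.-integrable setT (fun x => (u x)%:E) ->
   m2.-integrable setT (fun y => (v y)%:E) ->
   (m1 \x m2)%E.-integrable setT (EFin \o (fun z => u z.1 * v z.2)).
  exact: integrable_prod.
move=> [a b] [c e]; apply: eqc_parts; rewrite ?cReM ?cImM /= -!Rintegral_prod//.
- rewrite -(RintegralB measurableT (iP _ _ a c) (iP _ _ b e)).
  by apply: eq_Rintegral => z _; rewrite cReM.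
- rewrite -(RintegralD measurableT (iP _ _ a e) (iP _ _ b c)).
  by apply: eq_Rintegral => z _; rewrite cImM.
Qed.

End product_integral.

(** * Product integrands under the Lebesgue measure on tuples *)

Section tuple_integral.
Context {R : realType}.

Let tuple_uncons n (y : n.+1.-tuple R) : R * n.-tuple R :=
  (thead y, [tuple of behead y]).

Let tuple_consK n : cancel (@tuple_cons R n) (@tuple_uncons n).
Proof. by case=> x s; congr pair; exact/val_inj. Qed.

Let measurable_tuple_uncons n : measurable_fun setT (@tuple_uncons n).
Proof.
by apply: measurable_fun_pair; [exact: measurable_tnth|exact: measurable_behead].
Qed.

(** Change of variables along [tuple_cons]. The integrand on tuples is written through the inverse
    map, so that its pullback is [h] itself. *)
Let integral_cons_measure n (m : {sigma_finite_measure set (n.-tuple R) -> \bar R})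
    (h : R * n.-tuple R -> R) :
  (@lebesgue_measure R \x m)%E.-integrable setT (EFin \o h) ->
  (cons_measure m).-integrable setT (EFin \o (h \o @tuple_uncons n)) /\
  \int[cons_measure m]_y h (tuple_uncons _ y) =
  \int[(@lebesgue_measure R \x m)%E]_z h z.
Proof.
move=> ih.
have mh : measurable_fun setT (EFin \o (h \o @tuple_uncons n)).
  apply/measurable_EFinP; apply: measurableT_comp; last exact: measurable_tuple_uncons.
  by apply/measurable_EFinP; exact: measurable_int ih.
have hE : (EFin \o (h \o @tuple_uncons n)) \o @tuple_cons R n = EFin \o h.
  by apply/funext => z /=; rewrite tuple_consK.
have ih' : (@lebesgue_measure R \x m)%E.-integrable (@tuple_cons R n @^-1` setT)
    ((EFin \o (h \o @tuple_uncons n)) \o @tuple_cons R n).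
  by rewrite hE.
(* [lebesgue_measure] is a measure on the generated sigma-algebra
   [g_sigma_algebraType], whose display is not that of [R]. *)
have mc : measurable_fun setT
    (@tuple_cons R n : g_sigma_algebraType R.-ocitv.-measurable * n.-tuple R -> _).
  by move=> mT Y mY; exact: (@measurable_tuple_cons R n mT Y mY).
(* The two set functions agree by definition but carry different measure structures;
   [eq_measure_integral] identifies their integrals. *)
have eqm A : measurable A -> A `<=` setT ->
    cons_measure m A = pushforward (@lebesgue_measure R \x m)%E (@tuple_cons R n) A.
  by [].
split.
  have /integrableP[_ hoo] := integrable_pushforward mc mh ih' measurableT.
  apply/integrableP; split => //; apply: le_lt_trans hoo.
rewrite /Rintegral; congr fine.
have := integral_pushforward mc mh ih' measurableT.
by rewrite hE => <-; exact: eq_measure_integral.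
Qed.

Lemma cintegral_tuple_prodT n (f : 'I_n -> R -> R[i]) :
  (forall i, cintegrable lebesgue_measure setT (f i)) ->
  cintegrable (lebesgue_tuple R n) setT (fun x => \prod_(i < n) f i (tnth x i)) /\
  cintegral (lebesgue_tuple R n) setT (fun x => \prod_(i < n) f i (tnth x i)) =
  \prod_(i < n) cintegral lebesgue_measure setT (f i).
Proof.
elim: n f => [|n IH] f fi.
  rewrite big_ord0.
  have -> : (fun x : 0.-tuple R => \prod_(i < 0) f i (tnth x i)) = (fun=> 1).
    by apply/funext => x; rewrite big_ord0.
  split.
    apply: cintegrable_cst => //.
    by rewrite /= diracE mem_set// ltry.
  apply: eqc_parts; rewrite /= Rintegral_cst// ?mul0r// mul1r.
  by rewrite [X in fine X]diracE mem_set.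
have [ig cg] := IH (fun i => f (lift ord0 i)) (fun i => fi _).
set g := fun x : n.-tuple R => _ in ig cg.
have fE : (fun x : n.+1.-tuple R => \prod_(i < n.+1) f i (tnth x i)) =
   (fun z => f ord0 z.1 * g z.2) \o @tuple_uncons n.
  apply/funext => x; rewrite /= big_ord_recl; congr (_ * _).
  apply: eq_bigr => i _; congr (f _ _).
  by rewrite [in LHS](tuple_eta x) tnthS.
rewrite big_ord_recl -cg -cintegral_prod// fE.
have [iR iI] := cintegrable_prod _ _ _ _ (fi ord0) ig.
have [iR' cR] := integral_cons_measure _ _ _ iR.
have [iI' cI] := integral_cons_measure _ _ _ iI.
split; first by split.
by rewrite /cintegral; congr (_ +i* _).
Qed.

Lemma measurable_box n (A : 'I_n -> set R) : (forall i, measurable (A i)) ->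
  measurable [set x : n.-tuple R | forall i, A i (tnth x i)].
Proof.
move=> mA.
rewrite (_ : [set _ | _] =
    \bigcap_(i in [set: 'I_n]) ((@tnth n R ^~ i) @^-1` A i)).
  apply: fin_bigcap_measurable => // i _; rewrite -[X in measurable X]setTI.
  exact: measurable_tnth.
by apply/seteqP; split=> [x Bx i _|x Bx i]; exact: Bx.
Qed.

(** The indicator of a box is the product of the indicators of its sides, which reduces the claim to
    the whole space. *)
Lemma cintegral_tuple_prod n (A : 'I_n -> set R) (f : 'I_n -> R -> R[i]) :
  (forall i, measurable (A i)) ->
  (forall i, cintegrable lebesgue_measure (A i) (f i)) ->
  let B := [set x : n.-tuple R | forall i, A i (tnth x i)] in
  cintegrable (lebesgue_tuple R n) B (fun x => \prod_(i < n) f i (tnth x i)) /\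
  cintegral (lebesgue_tuple R n) B (fun x => \prod_(i < n) f i (tnth x i)) =
  \prod_(i < n) cintegral lebesgue_measure (A i) (f i).
Proof.
move=> mA fi B; have mB := measurable_box _ _ mA.
have [] := cintegral_tuple_prodT _ (fun i x => f i x * (\1_(A i) x)%:C).
  by move=> i; have [h _] := cintegrable_mkcond lebesgue_measure (A i) (f i) (mA i); apply: h.
have -> : (fun x : n.-tuple R => \prod_(i < n) (f i (tnth x i) * (\1_(A i) (tnth x i))%:C))
    = (fun x => \prod_(i < n) f i (tnth x i) * (\1_B x)%:C).
  apply/funext => x; rewrite big_split/=; congr (_ * _).
  rewrite indicE; have [xB|xB] := boolP (x \in B).
    rewrite big1// => i _; rewrite indicE mem_set//.
    by move: xB; rewrite inE; apply.
  move: xB; rewrite notin_setE => /existsNP[i Ai].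
  by rewrite (bigD1 i)//= indicE memNset// mul0r.
move=> h1 h2; split; first exact/cintegrable_mkcond.
by rewrite cintegral_mkcond h2; apply: eq_bigr => i _; rewrite -cintegral_mkcond.
Qed.

End tuple_integral.

(** * The fundamental theorem of calculus and the orthogonality of the characters of the circle *)

Section fundamental_theorem.
Context {R : realType}.
Notation mu := (@lebesgue_measure R).

(** Differentiability of [f] supplies its continuity, hence its integrability on the segment. *)
Lemma cintegral_FTC (F f : R -> R[i]) (a b : R) : a < b ->
  (forall x, a <= x <= b -> cderive F x (f x)) ->
  (forall x, a <= x <= b -> exists l, cderive f x l) ->
  cintegrable mu `[a, b] f /\ cintegral mu `[a, b] f = F b - F a.
Proof.
move=> ab dF df.
have real_case (U u : R -> R) :
    (forall x : R, a <= x <= b -> is_derive x 1 U (u x)) ->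
    (forall x : R, a <= x <= b -> derivable u x 1) ->
    mu.-integrable `[a, b] (EFin \o u) /\ (\int[mu]_(x in `[a, b]) u x)%R = U b - U a.
  move=> dU du.
  have cu : {within `[a, b], continuous u}.
    by apply: derivable_within_continuous => x /[!in_itv]/= /du.
  have cU x : a <= x <= b -> {for x, continuous U}.
    move=> /dU[dUx _]; exact/differentiable_continuous/derivable1_diffP.
  split; first by apply: continuous_compact_integrable => //; exact: segment_compact.
  rewrite /Rintegral (@continuous_FTC2 _ u U _ _ ab cu) => [//||].
  - split.
    + move=> x /[!in_itv]/= /andP[ax xb].
      by have [] : is_derive x 1 U (u x) by apply: dU; rewrite !ltW.
    + by apply: cvg_at_right_filter; apply: cU; rewrite lexx ltW.
    + by apply: cvg_at_left_filter; apply: cU; rewrite lexx ltW.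
  - move=> x /[!in_itv]/= /andP[ax xb]; rewrite derive1E.
    by have [] : is_derive x 1 U (u x) by apply: dU; rewrite !ltW.
have [iR eR] := real_case (fun x => complex.Re (F x)) (fun x => complex.Re (f x))
  (fun x h => (dF x h).1) (fun x h => let: ex_intro l hl := df x h in
     @ex_derive _ _ _ _ _ _ _ hl.1).
have [iI eI] := real_case (fun x => complex.Im (F x)) (fun x => complex.Im (f x))
  (fun x h => (dF x h).2) (fun x h => let: ex_intro l hl := df x h in
     @ex_derive _ _ _ _ _ _ _ hl.2).
split; first by split.
by apply: eqc_parts; rewrite ?cReD ?cImD ?cReN ?cImN.
Qed.

Lemma cexp_periodic (n : nat) : cexp ((n%:R * (2 * pi))%:C * 'i) = 1 :> R[i].
Proof.
elim: n => [|n IH].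
  by rewrite mul0r mul0r cexp0.
rewrite -natr1 mulrDl rmorphD /= mulrDl cexpD IH !mul1r /cexp /=.
rewrite !mul0r !mulr1 !mulr0 subr0 addr0 expR0 mul1r.
by rewrite mulrC mulr_natr cos2pi sin2pi.
Qed.

(** For [j != k] the primitive [f / (i (j - k))] takes the same value at both ends of the period. *)
Lemma cintegral_circle (j k : nat) :
  let f (x : R) := cexp (((j%:R - k%:R) * x)%:C * 'i) in
  cintegrable mu `[0, 2 * pi] f /\
  cintegral mu `[0, 2 * pi] f = (j == k)%:R * (2 * pi)%:C.
Proof.
have pi2 : 0 < 2 * pi :> R by rewrite mulr_gt0// pi_gt0.
move=> f; have [ejk|jk] := eqVneq j k.
  have muI : mu `[0, 2 * pi]%classic = (2 * pi)%:E.
    by rewrite lebesgue_measure_itv/= lte_fin pi2 sube0.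
  have -> : f = fun=> 1.
    by apply/funext => x; rewrite /f ejk subrr !mul0r cexp0.
  split; first by apply: cintegrable_cst; rewrite // [X in (X < _)%E]muI ltry.
  by apply: eqc_parts; rewrite mul1r /= Rintegral_cst// ?mul0r//
     [X in fine X]muI mul1r.
pose w : R := j%:R - k%:R.
have w0 : w != 0 by rewrite subr_eq0 eqr_nat.
pose z : R[i] := w%:C * 'i.
have z0 : z != 0 by rewrite mulf_neq0 ?eq_complex /= ?negb_and ?w0 ?oner_neq0 ?orbT.
have fE x : f x = cexp (z * x%:C).
  by rewrite /f /z -/w rmorphM /= mulrAC.
have dlin x : cderive (fun x : R => z * x%:C) x z.
  have := cderiveMl (fun x : R => x%:C) z x 1; rewrite mulr1; apply; split => /=.
  - exact: is_derive_id.
  - exact: is_derive_cst.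
have df x : cderive f x (z * cexp (z * x%:C)).
  by rewrite (_ : f = (fun x => cexp (z * x%:C))); [exact: cderive_cexp (dlin x)|exact/funext].
have [|||i1 e1] := @cintegral_FTC (fun x => z^-1 * f x) f 0 (2 * pi) => //.
- move=> x _; apply: cderive_eq; first exact: cderiveMl (df x).
  by rewrite mulrA mulVf// mul1r fE.
- by move=> x _; eexists; exact: df.
split => //; rewrite e1 mul0r -mulrBr /f.
(* [j - k] may be negative while [cexp_periodic] is about natural multiples of the period, so the
   exponent is split. *)
have -> : (w * (2 * pi))%:C * 'i = (j%:R * (2 * pi))%:C * 'i - (k%:R * (2 * pi))%:C * 'i :> R[i].
  by rewrite /w mulrBl rmorphB /= mulrBl.
have ek : cexp (- ((k%:R * (2 * pi))%:C * 'i)) = 1 :> R[i].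
  have := cexpD ((k%:R * (2 * pi : R))%:C * 'i) (- ((k%:R * (2 * pi))%:C * 'i)).
  by rewrite subrr cexp0 cexp_periodic mul1r => <-.
by rewrite cexpD cexp_periodic ek mulr0 mul0r cexp0 mulr1 subrr mulr0.
Qed.

End fundamental_theorem.

(** * Beta integrals with a complex exponent *)

Section beta_integral.
Context {R : realType}.
Notation mu := (@lebesgue_measure R).
Implicit Types (b : R[i]) (x : R).

(** The power [(1 - x)^(b - 1)] as a single exponential, without the case [z == 0] of [cpow]. *)
Let h b x : R[i] := cexp ((b - 1) * (ln (1 - x))%:C).

Let cpow_h b x : x < 1 -> cpow (1 - x%:C) (b - 1) = h b x.
Proof.
move=> x1; have x0 : 0 < 1 - x by rewrite subr_gt0.
have -> : 1 - x%:C = (1 - x)%:C by rewrite rmorphB.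
rewrite /cpow ifF; last by apply/eqP => -[] /eqP; rewrite gt_eqF.
congr (cexp (_ * _)); rewrite /cln /carg normc_real gtr0_norm//=.
by rewrite lexx divff ?gt_eqF// acos1.
Qed.

Let normc_cexp (z : R[i]) : normc (cexp z) = expR (complex.Re z).
Proof.
rewrite /cexp normcM normc_real gtr0_norm ?expR_gt0//=.
by rewrite cos2Dsin2 sqrtr1 mulr1.
Qed.

Let normc_h b x : normc (h b x) = expR ((complex.Re b - 1) * ln (1 - x)).
Proof. by rewrite normc_cexp cReZ cReD cReN. Qed.

Let cexp_real x : cexp x%:C = (expR x)%:C.
Proof. by rewrite /cexp /= cos0 sin0 -[1 +i* 0]/(1 : R[i]) mulr1. Qed.

(* Chosen so that [ln (1 - c n) = - n.+1]. *)
Let c (n : nat) : R := 1 - expR (- n.+1%:R).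

Let c01 n : 0 < c n < 1.
Proof.
by rewrite /c gtrBl expR_gt0 andbT subr_gt0 expR_lt1 oppr_lt0.
Qed.

Let le_c x : x < 1 -> exists N, forall n, (N <= n)%N -> x <= c n.
Proof.
move=> x1; have x0 : 0 < 1 - x by rewrite subr_gt0.
exists (Num.bound `|ln (1 - x)|) => n Nn; rewrite /c lerBrDr -lerBrDl.
rewrite -[leRHS]lnK ?posrE// ler_expR lerNl (le_trans (ler_norm _))// normrN.
by rewrite (le_trans (ltW (archi_boundP (normr_ge0 _))))// ler_nat leqW.
Qed.

(** The primitive is [- (1 - x)^b / b], and [(1 - c n)^b] is [exp (- b (n + 1))] by the choice of
    [c]. *)
Let integral_h b n : complex.Re b > 0 ->
  cintegrable mu `[0, c n] (h b) /\
  cintegral mu `[0, c n] (h b) = b^-1 * (1 - cexp (- b * n.+1%:R)).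
Proof.
move=> b0; have bn0 : b != 0 by apply: contraTneq b0 => ->; rewrite ltxx.
have [c0 c1] := andP (c01 n).
pose F x := - b^-1 * cexp (b * (ln (1 - x))%:C).
have dln x : x < 1 -> cderive (fun x => (ln (1 - x))%:C) x (- (1 - x)^-1)%:C.
  move=> x1; have x0 : 0 < 1 - x by rewrite subr_gt0.
  split => /=; last exact: is_derive_cst.
  rewrite (_ : (fun _ => _) = @ln R \o (fun r => 1 - r)); last by [].
  have d1 : is_derive x 1 (fun r : R => 1 - r) (- 1).
    rewrite (_ : (fun _ => _) = cst 1 - id); last by [].
    by apply: is_derive_eq; rewrite sub0r.
  have dl := is_derive1_ln x0.
  have := @is_derive1_comp R (@ln R) (fun r => 1 - r) x _ _ dl d1.
  by rewrite mulrN1.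
have dh b' x : x < 1 -> cderive (fun x => cexp (b' * (ln (1 - x))%:C)) x
     (b' * (- (1 - x)^-1)%:C * cexp (b' * (ln (1 - x))%:C)).
  by move=> x1; exact: cderive_cexp (cderiveMl _ b' _ _ (dln _ x1)).
have [|||i1 e1] := @cintegral_FTC _ F (h b) 0 (c n) => //.
- move=> x /andP[_ xc]; have x1 : x < 1 by apply: le_lt_trans c1.
  have x0 : 0 < 1 - x by rewrite subr_gt0.
  apply: cderive_eq; first exact: cderiveMl (dh b x x1).
  rewrite /h mulrBl mul1r cexpD.
  have -> : cexp (- (ln (1 - x))%:C) = (1 - x)^-1%:C.
    by rewrite -rmorphN cexp_real expRN lnK.
  rewrite rmorphN; set e := cexp _; set y := real_complex _ _; field.
  have : (1 - x)%:C != 0 :> R[i] by rewrite eq_complex /= eqxx andbT gt_eqF.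
  by rewrite bn0 andbT rmorphB.
- move=> x /andP[_ xc]; have x1 : x < 1 by apply: le_lt_trans c1.
  by eexists; exact: dh.
split => //; rewrite e1 /F subr0 ln1 mulr0 cexp0.
rewrite /c opprB addrCA subrr addr0 expRK.
rewrite rmorphN /= rmorph_nat mulrN [- b * _]mulNr; ring.
Qed.

(** Monotone convergence along the segments [[0, c n]], on which the integrals
    [(1 - exp (- a (n + 1))) / a] are at most [1 / a]. With [a = Re b] the function is the modulus
    of [h b]. *)
Let integrable_norm_h (a : R) : 0 < a ->
  mu.-integrable `[0, 1[ (EFin \o (fun x => expR ((a - 1) * ln (1 - x)))).
Proof.
move=> a0; set u := fun x => _.
have m1x : measurable_fun setT (fun x : R => 1 - x) by exact: measurable_funB.
have mu_ : measurable_fun setT u.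
  apply: measurableT_comp => //; apply: measurable_funM => //.
  exact: (measurableT_comp (@measurable_ln R) m1x).
have hu : u = (fun x => complex.Re (h a%:C x)).
  apply/funext => x; rewrite /h -[1]/(1%:C) -rmorphB -rmorphM /cexp /= cos0 sin0.
  by rewrite mulr1 mul0r subr0.
have nd : nondecreasing_seq (fun n => `[0, c n]%classic : set R).
  move=> n m nm; apply/subsetPset => x /=; rewrite !in_itv/= => /andP[-> xc]/=.
  by rewrite (le_trans xc)// lerB// ler_expR lerN2 ler_nat.
have cv : (\int[mu]_(x in `[0%R, c n]) (u x)%:E)%E @[n --> \oo] -->
    (\int[mu]_(x in \bigcup_n `[0%R, c n]%classic) (u x)%:E)%E.
  apply: (@ge0_nondecreasing_set_cvg_integral _ (measurableTypeR R) R (fun n => `[0, c n]%classic)) => //.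
  - by move=> n; exact/measurable_EFinP/measurable_funTS.
  - by move=> n x _; rewrite lee_fin expR_ge0.
have U : \bigcup_n `[0, c n]%classic = `[0, 1[%classic :> set R.
  apply/seteqP; split => [x [n _]|x] /=; rewrite !in_itv/= => /andP[x0 x1].
    by rewrite x0 (le_lt_trans x1)//; case/andP: (c01 n).
  by have [N cN] := le_c _ x1; exists N; rewrite //= in_itv/= x0 cN.
apply/integrableP; split; first exact/measurable_EFinP/measurable_funTS.
under eq_integral => x _ do rewrite /= ger0_norm ?expR_ge0//.
rewrite -U.
apply: (@le_lt_trans _ _ (a^-1)%:E); last by rewrite ltry.
rewrite -(cvg_lim _ cv)//; apply: lime_le; first by apply: cvgP cv.
apply: nearW => n.
have [[iR _] e] := integral_h a%:C n a0.
have -> : (\int[mu]_(x in `[0%R, c n]) (u x)%:E)%E =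
    (complex.Re (cintegral mu `[0, c n] (h a%:C)))%:E.
  rewrite /= -hu /Rintegral fineK//; move: iR.
  rewrite (_ : (fun x => (complex.Re (h a%:C x))%:E) = EFin \o u).
    exact: integrable_fin_num.
  by rewrite hu.
rewrite e lee_fin.
have -> : - a%:C * n.+1%:R = (- a * n.+1%:R)%:C by rewrite rmorphM rmorphN rmorph_nat.
by rewrite cexp_real -fmorphV -[X in _ * (X - _)]/(1%:C) -rmorphB -rmorphM /= ler_piMr ?invr_ge0 ?(ltW a0)//.
Qed.

Let cexp_cvg0 b : 0 < complex.Re b -> ccvg (fun n => cexp (- b * n.+1%:R)) 0.
Proof.
move=> b0; have cv0 : normc (cexp (- b * n.+1%:R)) @[n --> \oo] --> (0 : R).
  rewrite (_ : (fun _ => _) = (fun n => expR (- complex.Re b) ^+ n.+1)).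
    rewrite (cvg_shiftS (fun n => expR (- complex.Re b) ^+ n)).
    by apply: cvg_expr; rewrite ger0_norm ?expR_ge0// expR_lt1 oppr_lt0.
  apply/funext => n; rewrite normc_cexp -(rmorph_nat (real_complex R)) cReZ cReN.
  by rewrite -expRM_natr.
have sq (u : nat -> R) : (forall n, `|u n| <= normc (cexp (- b * n.+1%:R))) ->
    u @ \oo --> (0 : R).
  move=> uc; apply/cvgr0Pnorm_lt => e e0; move/cvgr0Pnorm_lt : cv0 => /(_ _ e0).
  apply: filterS => n; rewrite ger0_norm ?normc_ge0//; exact: le_lt_trans.
by split; apply: sq => n; [exact: ler_normc_Re|exact: ler_normc_Im].
Qed.

(** For [Re b < 1] the integrand is unbounded at 1, so it is cut off by the indicator of [[0, c n]];
    the cut-offs converge pointwise and are dominated by the modulus of [h b]. *)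
Lemma cintegral_cpow b : 0 < complex.Re b ->
  cintegrable mu `]0, 1[ (fun x => cpow (1 - x%:C) (b - 1)) /\
  cintegral mu `]0, 1[ (fun x => cpow (1 - x%:C) (b - 1)) = b^-1.
Proof.
move=> b0.
have [ih eh] : cintegrable mu `[0, 1[ (h b) /\ cintegral mu `[0, 1[ (h b) = b^-1.
  pose F n x := h b x * (\1_(`[0, c n]%classic) x)%:C.
  have FE n : cintegrable mu `[0, 1[ (F n) /\
      cintegral mu `[0, 1[ (F n) = cintegral mu `[0, c n] (h b).
    have [ih _] := integral_h b n b0.
    have E : (fun x => F n x * (\1_(`[0, 1[%classic) x)%:C) = F n.
      apply/funext => x; rewrite /F -mulrA -rmorphM; congr (_ * _%:C).
      rewrite !indicE; have [xn|] := boolP (x \in `[0, c n]%classic); last by rewrite mul0r.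
      rewrite mem_set ?mulr1//; move: xn; rewrite inE/= !in_itv/= => /andP[-> xc]/=.
      by rewrite (le_lt_trans xc)//; case/andP: (c01 n).
    split.
      apply/(cintegrable_mkcond mu _ _ (measurable_itv _)); rewrite E.
      exact/(cintegrable_mkcond mu _ _ (measurable_itv _)).
    by rewrite cintegral_mkcond E -cintegral_mkcond.
  have [|n|x|||ih ch] := @cintegral_dominated _ _ _ mu `[0, 1[ F (h b)
      (fun x => expR ((complex.Re b - 1) * ln (1 - x))).
  - exact: measurable_itv.
  - exact: (FE n).1.
  - rewrite /= in_itv/= => /andP[x0 x1].
    have [N cN] := le_c _ x1.
    have FN n : (N <= n)%N -> F n x = h b x.
      by move=> Nn; rewrite /F indicE mem_set ?mulr1//= in_itv/= x0 cN.
    split; apply: cvg_near_cst; exists N => // n Nn.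
    + by rewrite (FN n Nn).
    + by rewrite (FN n Nn).
  - exact: integrable_norm_h.
  - move=> n x _; rewrite normcM normc_h normc_real ler_piMr ?expR_ge0//.
    by rewrite indicE; case: (x \in _); rewrite ?normr1 ?normr0 ?ler01.
  split => //; apply: ccvg_unique ch _.
  rewrite (_ : (fun n => _) = (fun n => b^-1 * (1 + -1 * cexp (- b * n.+1%:R)))).
    rewrite -[X in ccvg _ X]mulr1 -[X in _ * X]addr0 -[X in _ + X](mulr0 (-1)).
    by apply: ccvgMl; apply: ccvgD; [exact: ccvg_cst|exact/ccvgMl/cexp_cvg0].
  by apply/funext => n; rewrite (FE n).2 (integral_h b n b0).2 mulN1r.
(* The segments exhaust [[0, 1[]; passing to []0, 1[] removes a null set. *)
have ho : cintegrable mu `]0, 1[ (h b).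
  have sub : (`]0, 1[%classic : set R) `<=` `[0, 1[%classic by exact: subset_itv_oo_co.
  by case: ih => a b'; split; [apply: integrableS a|apply: integrableS b'].
have hE x : `]0, 1[%classic x -> h b x = cpow (1 - x%:C) (b - 1).
  by rewrite /= in_itv/= => /andP[_ x1]; rewrite cpow_h.
split; first by apply: eq_cintegrable ho => //; exact: measurable_itv.
rewrite -eh -(eq_cintegral mu _ _ _ hE).
by rewrite /cintegral !Rintegral_itv_obnd_cbnd//; case: ho.
Qed.

(** Expresses the modulus of the kernel as a kernel of the same kind with real exponent, so that the
    majorant on the hypercube is integrable by [cintegral_cpow] again. *)
Lemma cpow_Re b x : x < 1 ->
  cpow (1 - x%:C) ((complex.Re b)%:C - 1) = (normc (cpow (1 - x%:C) (b - 1)))%:C.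
Proof.
move=> x1; rewrite !cpow_h// normc_h /h -[X in _ - X]/(1%:C).
by rewrite -rmorphB -rmorphM /= cexp_real.
Qed.

Let cpowD1 b x : x < 1 ->
  cpow (1 - x%:C) (b + 1 - 1) = (1 - x%:C) * cpow (1 - x%:C) (b - 1).
Proof.
move=> x1; rewrite !cpow_h// /h.
have -> : (b + 1 - 1) * (ln (1 - x))%:C = (ln (1 - x))%:C + (b - 1) * (ln (1 - x))%:C.
  by ring.
by rewrite cexpD cexp_real lnK ?posrE ?subr_gt0// rmorphB.
Qed.

Lemma pochhammerSl b n : pochhammer b n.+1 = b * pochhammer (b + 1) n.
Proof.
rewrite /pochhammer big_ord_recl addr0; congr (_ * _); apply: eq_bigr => i _.
by rewrite lift0 -natr1 addrA addrAC.
Qed.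

Lemma pochhammer_neq0 b n : 0 < complex.Re b -> pochhammer b n != 0.
Proof.
move=> b0; apply/prodf_neq0 => i _; apply: contraTneq b0 => /(congr1 (@complex.Re R)).
rewrite cReD -(rmorph_nat (real_complex R)) /= => h0; rewrite -leNgt.
by have := ler0n R i; lra.
Qed.

(* By induction on [n] for all [b]: [x^(n+1) = x^n - (1 - x) x^n]. *)
Lemma cintegral_beta b n : 0 < complex.Re b ->
  cintegrable mu `]0, 1[ (fun x => cpow (1 - x%:C) (b - 1) * x%:C ^+ n) /\
  cintegral mu `]0, 1[ (fun x => cpow (1 - x%:C) (b - 1) * x%:C ^+ n) =
  n`!%:R / pochhammer b n.+1.
Proof.
elim: n b => [|n IH] b b0.
  have [i0 e0] := cintegral_cpow _ b0.
  rewrite pochhammerSl /pochhammer big_ord0 mulr1 fact0 mul1r -e0.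
  by rewrite (_ : (fun x => _ * x%:C ^+ 0) = (fun x => cpow (1 - x%:C) (b - 1)))//;
    apply/funext => x; rewrite expr0 mulr1.
have b1 : 0 < complex.Re (b + 1) by rewrite cReD /= addr_gt0.
have [i0 e0] := IH _ b0; have [i1 e1] := IH _ b1.
pose F (k : bool) x := if k then cpow (1 - x%:C) (b - 1) * x%:C ^+ n
  else -1 * (cpow (1 - x%:C) (b + 1 - 1) * x%:C ^+ n).
have m01 : measurable (`]0, 1[%classic : set R) by exact: measurable_itv.
have iF k : cintegrable mu `]0, 1[ (F k).
  by case: k => //; exact: cintegrableMl.
have FE x : `]0, 1[%classic x ->
    \sum_(k <- [:: true; false]) F k x = cpow (1 - x%:C) (b - 1) * x%:C ^+ n.+1.
  rewrite /= in_itv/= => /andP[_ x1].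
  by rewrite !big_cons big_nil /F cpowD1// exprS; ring.
split.
  by apply: (eq_cintegrable mu _ _ _ _ FE) => //; exact: cintegrable_sum.
rewrite -(eq_cintegral mu _ _ _ FE) cintegral_sum// !big_cons big_nil addr0.
rewrite {1}/F [in X in _ + X]/F cintegralMl// e0 e1.
have nz := pochhammer_neq0 _ n b1.
have b00 : b != 0 by have := pochhammer_neq0 _ 1 b0; rewrite pochhammerSl mulf_eq0 => /norP[].
have bn0 : b + 1 + n%:R != 0.
  by have := pochhammer_neq0 _ n.+1 b1; rewrite /pochhammer big_ord_recr mulf_eq0 => /norP[].
rewrite pochhammerSl (pochhammerSl b n.+1) /pochhammer big_ord_recr/= -/(pochhammer _ _).
rewrite factS natrM -natr1; field.
by rewrite b00 bn0 nz.
Qed.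

End beta_integral.

(** * The residuum on the torus of a product of power series in the [a_j] *)

Section residue_of_power_series.
Context {R : realType}.

Lemma cexpX (z : R[i]) n : cexp z ^+ n = cexp (n%:R * z).
Proof.
elim: n => [|n IH]; first by rewrite expr0 mul0r cexp0.
by rewrite exprS IH -cexpD -[in RHS]nat1r mulrDl mul1r.
Qed.

Lemma cexp_sum I (s : seq I) (P : pred I) (F : I -> R[i]) :
  cexp (\sum_(i <- s | P i) F i) = \prod_(i <- s | P i) cexp (F i).
Proof. by elim/big_rec2: _ => [|i a b _ <-]; rewrite ?cexp0 ?cexpD. Qed.

Lemma normc_cexp_i (x : R) : normc (cexp (x%:C * 'i)) = 1.
Proof.
rewrite /cexp normcM normc_real gtr0_norm ?expR_gt0// cReM /= mulr0 mul0r subrr.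
by rewrite expR0 mul1r cos2Dsin2 sqrtr1.
Qed.

Variable q : nat.
Implicit Types phi : q.-tuple R.

Let widen_eq (k j : 'I_q) :
  (widen_ord (leqnSn q) k == widen_ord (leqnSn q) j) = (k == j).
Proof. by []. Qed.

(** Each of the [q] forms [da_j / a_j] pulls back to [i dphi_j], so the matrix is [i] times the
    identity. *)
Let gelfand_leray_torus phi : gelfand_leray (torus phi) (dtorus phi) = 'i ^+ q.
Proof.
rewrite /gelfand_leray -(det_scalar q); congr (\det _); apply/matrixP => k j.
rewrite !mxE [_ == ord_max]lt_eqF ?ltEord /= ?ltn_ord// subr0 mulfK ?cexp_neq0//.
by rewrite widen_eq; case: eqP; rewrite ?mul1r ?mul0r.
Qed.

Let torus_widen phi (k : 'I_q) :
  torus phi 0 (widen_ord (leqnSn q) k) = cexp ((tnth phi k)%:C * 'i).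
Proof.
suff E : \sum_l torus_arg R q l (widen_ord (leqnSn q) k) * tnth phi l = tnth phi k.
  by rewrite mxE E.
have nmax : (widen_ord (leqnSn q) k == ord_max) = false.
  by rewrite lt_eqF// ltEord /= ltn_ord.
rewrite (bigD1 k)//= mxE eqxx nmax subr0 mul1r big1 ?addr0// => l lk.
by rewrite mxE widen_eq (negbTE lk) nmax subr0 mul0r.
Qed.

Let torus_max phi :
  torus phi 0 ord_max = \prod_(k < q) cexp (- (tnth phi k)%:C * 'i).
Proof.
suff E : \sum_l torus_arg R q l ord_max * tnth phi l = - \sum_l tnth phi l.
  rewrite mxE E -cexp_sum -mulr_suml rmorphN rmorph_sum sumrN //.
rewrite -sumrN; apply: eq_bigr => k _; rewrite mxE eqxx.
by rewrite lt_eqF ?ltEord /= ?ltn_ord// sub0r mulN1r.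
Qed.

Let normc_torus phi j : normc (torus phi 0 j) = 1.
Proof. by rewrite mxE normc_cexp_i. Qed.

(** The last coordinate is the inverse of the product of the others, so its exponent is subtracted
    from each of the other ones; the monomial becomes a product of characters in separate
    variables. *)
Let torus_monomial phi (m : 'I_q.+1 -> nat) :
  \prod_j torus phi 0 j ^+ m j =
  \prod_(k < q) cexp ((((m (widen_ord (leqnSn q) k))%:R - (m ord_max)%:R)
     * tnth phi k)%:C * 'i).
Proof.
rewrite big_ord_recr /= torus_max -prodrXl -big_split /=; apply: eq_bigr => k _.
rewrite torus_widen !cexpX -cexpD; congr cexp.
by rewrite rmorphM rmorphB !rmorph_nat; ring.
Qed.

Let box : set (q.-tuple R) := [set phi | forall k, 0 <= tnth phi k <= 2 * pi].

Let boxE : box = [set phi | forall k, `[0, 2 * pi]%classic (tnth phi k)].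
Proof. by apply/seteqP; split=> phi /= h k; have := h k; rewrite /= in_itv. Qed.

Let measurable_pibox : measurable box.
by rewrite boxE; apply: (@measurable_box R q (fun=> `[0, 2 * pi]%classic)) => k; exact: measurable_itv.
Qed.


Let box_lty : (lebesgue_tuple R q box < +oo)%E.
Proof.
have two_pi : 0 < 2 * pi :> R by rewrite mulr_gt0// pi_gt0.
rewrite boxE (@lebesgue_tuple_box R q (fun=> `[0, 2 * pi]%classic))//.
under eq_bigr do rewrite lebesgue_measure_itv /= lte_fin two_pi sube0.
by rewrite prodEFin ltry.
Qed.

Let cintegral_torus_monomial (m : 'I_q.+1 -> nat) :
  cintegrable (lebesgue_tuple R q) box (fun phi => \prod_j torus phi 0 j ^+ m j) /\
  cintegral (lebesgue_tuple R q) box (fun phi => \prod_j torus phi 0 j ^+ m j) =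
  \prod_(k < q) ((m (widen_ord (leqnSn q) k) == m ord_max)%:R * (2 * pi)%:C).
Proof.
rewrite (_ : (fun phi => _) = fun phi => \prod_(k < q)
   cexp ((((m (widen_ord (leqnSn q) k))%:R - (m ord_max)%:R) * tnth phi k)%:C * 'i)).
  have [] := @cintegral_tuple_prod R q (fun=> `[0, 2 * pi]%classic)
    (fun k x => cexp ((((m (widen_ord (leqnSn q) k))%:R - (m ord_max)%:R) * x)%:C * 'i)).
  - by move=> _; exact: measurable_itv.
  - by move=> k; have [] := @cintegral_circle R (m (widen_ord (leqnSn q) k)) (m ord_max).
  rewrite -boxE => h1 h2; split => //; rewrite h2; apply: eq_bigr => k _.
  by have [_ ->] := @cintegral_circle R (m (widen_ord (leqnSn q) k)) (m ord_max).
by apply/funext => phi; exact: torus_monomial.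
Qed.

(** Cancels the ['i ^+ q] of the pulled-back form against the normalization [(2 pi i)^-q]. *)
Let expfVMK (F : fieldType) (x y z : F) n : y != 0 ->
  (x * y)^-1 ^+ n * (y ^+ n * z) = x ^- n * z.
Proof. by move=> y0; rewrite exprVn exprMn invfM -mulrA mulKf ?expf_neq0. Qed.

Lemma Res_power_series (c : 'I_q.+1 -> nat -> R[i]) (g : 'I_q.+1 -> R[i] -> R[i])
    (eta : R) :
  0 <= eta ->
  (forall j w, normc w = 1 ->
     ccvg (fun N => \sum_(n < N) c j n * (w * eta%:C) ^+ n) (g j (w * eta%:C))) ->
  (forall j, exists B, forall N, \sum_(n < N) normc (c j n) * eta ^+ n <= B) ->
  ccvg (fun N => \sum_(n < N) (\prod_j c j n) * (eta ^+ q.+1)%:C ^+ n)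
    (Res (fun a V => \prod_j g j (a 0 j * eta%:C) * gelfand_leray a V)).
Proof.
move=> eta0 cg /choice[B cB].
(* All factors are truncated at the same [N], so the product expands into a finite sum over
   multi-indices, whose constant members are exactly the [n < N]. No multiple series arises. *)
pose F N phi := \prod_j \sum_(n < N) c j n * (torus phi 0 j * eta%:C) ^+ n.
have FE N phi : F N phi = \sum_(m : {ffun 'I_q.+1 -> 'I_N})
    (\prod_j (c j (m j) * eta%:C ^+ m j)) * \prod_j torus phi 0 j ^+ m j.
  rewrite /F bigA_distr_bigA; apply: eq_bigr => m _; rewrite -big_split/=.
  by apply: eq_bigr => j _; rewrite exprMn; ring.
have iM N (m : {ffun 'I_q.+1 -> 'I_N}) : cintegrable (lebesgue_tuple R q) box
    (fun phi => (\prod_j (c j (m j) * eta%:C ^+ m j)) * \prod_j torus phi 0 j ^+ m j).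
  by apply: cintegrableMl => //; have [] := cintegral_torus_monomial (fun j => m j).
have iF N : cintegrable (lebesgue_tuple R q) box (F N).
  rewrite (funext (FE N)).
  exact: cintegrable_sum.
have eF N : cintegral (lebesgue_tuple R q) box (F N) =
    (2 * pi)%:C ^+ q * \sum_(n < N) (\prod_j c j n) * (eta ^+ q.+1)%:C ^+ n.
  rewrite (funext (FE N)).
  rewrite cintegral_sum// mulr_sumr.
  (* Multi-indices are grouped by their last entry [n]; in each group every member but the constant
     one has an entry different from [n], and its integral vanishes. *)
  rewrite (partition_big (fun m : {ffun 'I_q.+1 -> 'I_N} => m ord_max) xpredT)//=.
  apply: eq_bigr => n _; rewrite (bigD1 [ffun=> n])/= ?ffunE ?eqxx//.
  have eM (m : {ffun 'I_q.+1 -> 'I_N}) := cintegralMl (lebesgue_tuple R q) box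
     (\prod_j (c j (m j) * eta%:C ^+ m j)) _ measurable_pibox
     (cintegral_torus_monomial (fun j => m j)).1.
  rewrite [X in _ + X]big1 => [|m /= /andP[/eqP mn mcst]]; last first.
    rewrite eM (cintegral_torus_monomial (fun j => m j)).2.
    have [k mk] : exists k, m (widen_ord (leqnSn q) k) != n.
      apply/existsP; apply: contraNT mcst => /existsPn h; apply/eqP/ffunP => j.
      rewrite ffunE; have [jq|] := ltnP j q; last first.
        move=> qj; rewrite -mn; congr (m _); apply/val_inj/eqP => /=.
        by rewrite eqn_leq qj -ltnS ltn_ord.
      have /negPn/eqP <- := h (Ordinal jq); congr (m _); exact/val_inj.
    have mkN : (m (widen_ord (leqnSn q) k) == n :> nat) = false.
      by rewrite val_eqE (negbTE mk).
    by rewrite (bigD1 k)//= mn mkN !mul0r mulr0.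
  rewrite addr0 eM (cintegral_torus_monomial (fun j => [ffun=> n] j)).2.
  rewrite [X in _ * X](_ : _ = (2 * pi)%:C ^+ q); last first.
    rewrite (eq_bigr (fun=> (2 * pi)%:C)) => [|k _]; last by rewrite !ffunE eqxx mul1r.
    by rewrite prodr_const card_ord.
  rewrite mulrC; congr (_ * _).
  rewrite (eq_bigr (fun j => c j n * eta%:C ^+ n)) => [|j _]; last by rewrite ffunE.
  by rewrite big_split/= prodr_const card_ord rmorphXn -!exprM mulnC.
have B0 j : 0 <= B j.
  by have := cB j 0%N; rewrite big_ord0.
have [|||ig cv] := cintegral_dominated (lebesgue_tuple R q) box F
    (fun phi => \prod_j g j (torus phi 0 j * eta%:C)) (fun=> \prod_j B j) measurable_pibox iF.
- by move=> phi _; apply: ccvg_prod => j _; exact/cg/normc_torus.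
- exact: (cintegrable_cst _ _ (\prod_j B j)%:C measurable_pibox box_lty).1.
- move=> N phi _; rewrite normc_prod; apply: ler_prod => j _; rewrite normc_ge0 andTb. 
  apply: (le_trans (normc_sum _ _ _ _)); apply: le_trans (cB j N).
  apply: ler_sum => n _.
  by rewrite normcM normcX normcM normc_torus mul1r normc_real ger0_norm.
rewrite /Res.
have tp : (2 * pi)%:C = 2 * pi%:C :> R[i] by rewrite rmorphM rmorph_nat.
have tp0 : 2 * pi%:C != 0 :> R[i].
  by rewrite -tp eq_complex /= negb_and mulf_neq0// gt_eqF// pi_gt0.
have -> : (fun phi => \prod_j g j (torus phi 0 j * eta%:C) *
    gelfand_leray (torus phi) (dtorus phi)) =
  (fun phi => 'i ^+ q * \prod_j g j (torus phi 0 j * eta%:C)).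
  by apply/funext => phi; rewrite gelfand_leray_torus mulrC.
rewrite cintegralMl; [|exact: measurable_pibox|exact: ig].
have i0 : 'i != 0 :> R[i] by rewrite eq_complex /= negb_and oner_neq0 orbT.
rewrite expfVMK//.
apply: ccvg_ext (ccvgMl ((2 * pi%:C) ^- q) _ _ cv) _ => N.
by rewrite eF tp mulKf// expf_neq0.
Qed.

End residue_of_power_series.

(** * The residuum of the integrand of the theorem *)

Section hypergeometric_integral.
Context {R : realType}.
Variables (p q : nat) (hp : (p < q.+1)%N).
Variables (alpha : 'I_p -> R[i]) (v : R[i]).

(* Taylor coefficients in [a_j eta] of the [j]-th factor of the integrand:
   [(1 - a_j eta)^(- alpha_j)] for [j < p], [exp(v a_j eta)] for [j >= p]. *)
Let coeff (j : 'I_q.+1) (n : nat) : R[i] :=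
  if insub (val j) is Some i then pochhammer (alpha i) n / n`!%:R
  else v ^+ n / n`!%:R.

Let factor (j : 'I_q.+1) (z : R[i]) : R[i] :=
  if insub (val j) is Some i then cpow (1 - z) (- alpha i) else cexp (v * z).

Let subexp_coeff j : subexp (coeff j).
Proof.
rewrite /coeff; case: insubP => [i _ _|_];
  [exact: subexp_binomial|exact: subexp_exponential].
Qed.

Let prod_split (F : 'I_p -> R[i]) (G : 'I_q.+1 -> R[i]) :
  \prod_(j < q.+1) (if insub (val j) is Some i then F i else G j) =
  \prod_(i < p) F i * \prod_(j < q.+1 | (p <= j)%N) G j.
Proof.
rewrite (bigID (fun j : 'I_q.+1 => (j < p)%N))/=; congr (_ * _).
  rewrite (big_ord_narrow (ltnW hp)); apply: eq_bigr => i _ /=.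
  rewrite (insubT (fun k => (k < p)%N) (ltn_ord i)) /=.
  by congr F; exact/val_inj.
rewrite (eq_bigl (fun j : 'I_q.+1 => (p <= j)%N)) => [|j]; last by rewrite -leqNgt.
by apply: eq_bigr => j pj; rewrite insubF// ltnNge pj.
Qed.

Let card_tail : #|[pred j : 'I_q.+1 | (p <= j)%N]| = (q.+1 - p)%N.
Proof.
rewrite -sum1_card -[RHS]muln1 -sum_nat_const_nat big_geq_mkord.
by apply: eq_bigl => j; rewrite inE.
Qed.

(** Each of the [q + 1] factors contributes one [1/n!], and [v] enters only through
    [v ^+ (q.+1 - p)]; this is why any choice of the root [t^kappa] gives the same value. *)
Let prod_coeff n : \prod_j coeff j n =
  \prod_(i < p) pochhammer (alpha i) n * (v ^+ (q.+1 - p)) ^+ n / n`!%:R ^+ q.+1.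
Proof.
rewrite /coeff prod_split big_split/= !prodr_const card_ord card_tail exprMn.
have -> : n`!%:R ^+ q.+1 = n`!%:R ^+ p * n`!%:R ^+ (q.+1 - p) :> R[i].
  by rewrite -exprD subnKC// ltnW.
by rewrite invfM exprAC !exprVn; ring.
Qed.

Let prod_factor (a : 'rV[R[i]]_q.+1) (eta : R) :
  \prod_j factor j (a 0 j * eta%:C) =
  \prod_(j < p) cpow (1 - a 0 (widen_ord (ltnW hp) j) * eta%:C) (- alpha j)
  * cexp (eta%:C * v * \sum_(j < q.+1 | (p <= j)%N) a 0 j).
Proof.
rewrite mulr_sumr cexp_sum.
rewrite -(prod_split (fun j => cpow (1 - a 0 (widen_ord (ltnW hp) j) * eta%:C) (- alpha j))).
apply: eq_bigr => j _; rewrite /factor; case: insubP => [i _ ij|_].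
  by congr (cpow (1 - a 0 _ * _) _); exact/val_inj.
by congr cexp; ring.
Qed.

(** Absolute convergence at [eta = 1], which yields a bound on the residuum uniform over the
    hypercube. *)
Lemma summable_confluent : exists B : R, forall N, \sum_(n < N)
  normc (\prod_(i < p) pochhammer (alpha i) n * (v ^+ (q.+1 - p)) ^+ n / n`!%:R ^+ q.+1)
  <= B.
Proof.
have /choice[M hM] : forall j, exists m, forall n, normc (coeff j n) <= m * 2 ^+ n.
  by move=> j; apply: subexp_coeff; rewrite ltr1n.
(* Of the [q + 2] powers of 2, [q] pay for the bounds on the other coefficients, one for the weight
   [2 ^+ n] in [c] below, and one for the [2 ^+ n] on the right-hand side here. Thus [c] comes out
   bounded. *)
have [L hL] : exists L, forall n,
    normc ((v * (2 ^+ q.+2)%:C) ^+ n / n`!%:R) <= L * 2 ^+ n.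
  by apply: subexp_exponential; rewrite ltr1n.
have coeff_max n : coeff ord_max n = v ^+ n / n`!%:R.
  by rewrite /coeff insubF//= ltnNge -ltnS hp.
(* As [p <= q], the last factor is an exponential; its coefficients [v^n / n!]
   absorb the geometric growth of all the others. *)
pose c n := (\prod_j coeff j n) * (2 ^+ n)%:C.
have M0 j : 0 <= M j.
  by have := hM j 0%N; rewrite expr0 mulr1; exact/le_trans/normc_ge0.
have sc : subexp c.
  move=> s s1; exists (\prod_(k < q) M (widen_ord (leqnSn q) k) * L) => n.
  have sn : 1 <= s ^+ n by rewrite exprn_ege1// ltW.
  have L0 : 0 <= L.
    by have := hL 0%N; rewrite !expr0 mulr1; exact/le_trans/normc_ge0.
  apply: le_trans (ler_peMr _ sn); last by rewrite mulr_ge0// prodr_ge0.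
  rewrite /c normcM normc_real ger0_norm ?exprn_ge0// normc_prod big_ord_recr/=.
  have h1 : \prod_(k < q) normc (coeff (widen_ord (leqnSn q) k) n) <=
      \prod_(k < q) M (widen_ord (leqnSn q) k) * (2 ^+ n) ^+ q.
    rewrite -[X in (_ ^+ _) ^+ X]card_ord -prodr_const -big_split/=.
    by apply: ler_prod => k _; rewrite normc_ge0 hM.
  have h2 : normc (coeff ord_max n) * 2 ^+ n * (2 ^+ n) ^+ q <= L.
    rewrite -(ler_pM2r (exprn_gt0 n (ltr0Sn R 1))) (le_trans _ (hL n))//.
    have -> : (v * (2 ^+ q.+2)%:C) ^+ n / n`!%:R = coeff ord_max n * (2 ^+ q.+2)%:C ^+ n.
      by rewrite coeff_max exprMn mulrAC.
    rewrite [leRHS]normcM normcX normc_real.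
    rewrite [`|2 ^+ q.+2|]ger0_norm ?exprn_ge0//.
    by rewrite exprAC 2!exprS !exprMn le_eqVlt; apply/orP; left; apply/eqP; ring.
  rewrite -mulrA (le_trans (ler_wpM2r _ h1))// ?mulr_ge0 ?normc_ge0 ?exprn_ge0//.
  by rewrite -mulrA ler_wpM2l ?prodr_ge0// mulrC.
(* Summing [c] at [1/2] cancels its weight [2 ^+ n] and leaves the series at radius 1. *)
have half01 : 0 <= (2^-1 : R) < 1 by rewrite invr_ge0 ler0n/= invf_lt1// ltr1n.
have [B hB] := subexp_sum_bound _ _ sc half01.
exists B => N; apply: le_trans (hB N); apply: ler_sum => n _.
rewrite -prod_coeff /c normcM normc_real ger0_norm ?exprn_ge0// -mulrA -exprMn.
by rewrite divff ?pnatr_eq0// expr1n mulr1.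
Qed.

Lemma Res_confluent (eta : R) : 0 <= eta < 1 ->
  ccvg (fun N => \sum_(n < N)
      (\prod_(i < p) pochhammer (alpha i) n * (v ^+ (q.+1 - p)) ^+ n / n`!%:R ^+ q.+1)
      * (eta ^+ q.+1)%:C ^+ n)
    (Res (fun a V =>
      \prod_(j < p) cpow (1 - a 0 (widen_ord (ltnW hp) j) * eta%:C) (- alpha j)
      * cexp (eta%:C * v * \sum_(j < q.+1 | (p <= j)%N) a 0 j)
      * gelfand_leray a V)).
Proof.
move=> eta01; have /andP[eta0 eta1] := eta01.
have neta : `|eta| < 1 by rewrite ger0_norm.
have h1 j w : normc w = 1 -> ccvg (fun N => \sum_(n < N) coeff j n * (w * eta%:C) ^+ n)
    (factor j (w * eta%:C)).
  move=> w1; rewrite /coeff /factor; case: insubP => [i _ _|_].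
  - by apply: cpow_series; rewrite ?w1.
  - by apply: cexp_series; rewrite ?w1.
have h2 j : exists B, forall N, \sum_(n < N) normc (coeff j n) * eta ^+ n <= B.
  exact: subexp_sum_bound.
rewrite [X in Res X](_ : _ = fun (a : 'rV[R[i]]_q.+1) V =>
    \prod_j factor j (a 0 j * eta%:C) * gelfand_leray a V); last first.
  by apply/funext => a; apply/funext => V; rewrite prod_factor.
apply: ccvg_ext (Res_power_series _ _ _ _ eta0 h1 h2) _ => N.
by apply: eq_bigr => n _; rewrite prod_coeff.
Qed.

End hypergeometric_integral.

(** * Termwise integration over the hypercube *)

Section hypercube_integral.
Context {R : realType}.
Variables (q : nat) (b : 'I_q -> R[i]).
Hypothesis b_gt0 : forall i, 0 < complex.Re (b i).

Let hypercubeE : hypercube R q = [set x | forall i, `]0, 1[%classic (tnth x i)].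
Proof. by apply/seteqP; split=> x /= h k; have := h k; rewrite /= in_itv. Qed.

Lemma measurable_hypercube : measurable (hypercube R q).
Proof.
rewrite hypercubeE; apply: (@measurable_box R q (fun=> `]0, 1[%classic)) => k.
exact: measurable_itv.
Qed.

Let kernel (tau : q.-tuple R) : R[i] := \prod_i cpow (1 - (tnth tau i)%:C) (b i - 1).

Let kernel_monomial n :
  cintegrable (lebesgue_tuple R q) (hypercube R q)
    (fun tau => kernel tau * (\prod_i tnth tau i)%:C ^+ n) /\
  cintegral (lebesgue_tuple R q) (hypercube R q)
    (fun tau => kernel tau * (\prod_i tnth tau i)%:C ^+ n) =
  \prod_i (n`!%:R / pochhammer (b i) n.+1).
Proof.
have -> : (fun tau => kernel tau * (\prod_i tnth tau i)%:C ^+ n) = fun tau =>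
    \prod_i (cpow (1 - (tnth tau i)%:C) (b i - 1) * (tnth tau i)%:C ^+ n).
  by apply/funext => tau; rewrite rmorph_prod -prodrXl -big_split.
have [|i|] := @cintegral_tuple_prod R q (fun=> `]0, 1[%classic)
    (fun i x => cpow (1 - x%:C) (b i - 1) * x%:C ^+ n).
- by move=> _; exact: measurable_itv.
- by have [] := cintegral_beta _ n (b_gt0 i).
rewrite -hypercubeE => h1 h2; split => //; rewrite h2; apply: eq_bigr => i _.
by have [_ ->] := cintegral_beta _ n (b_gt0 i).
Qed.

(** As [|tau_1 ... tau_q| <= 1], the partial sums are bounded by [B], and [B] times the modulus of
    the kernel is an integrable majorant. *)
Lemma cintegral_hypercube (A : nat -> R[i]) (f : q.-tuple R -> R[i]) :
  (exists B : R, forall N, \sum_(n < N) normc (A n) <= B) ->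
  (forall tau, hypercube R q tau ->
    ccvg (fun N => \sum_(n < N) A n * (\prod_i tnth tau i)%:C ^+ n) (f tau)) ->
  let g tau := \prod_i cpow (1 - (tnth tau i)%:C) (b i - 1) * f tau in
  cintegrable (lebesgue_tuple R q) (hypercube R q) g /\
  ccvg (fun N => \sum_(n < N) A n * \prod_i (n`!%:R / pochhammer (b i) n.+1))
    (cintegral (lebesgue_tuple R q) (hypercube R q) g).
Proof.
move=> [B hB] Af g; have mQ := measurable_hypercube.
pose F N tau := \sum_(n < N) A n * (kernel tau * (\prod_i tnth tau i)%:C ^+ n).
have iA n : cintegrable (lebesgue_tuple R q) (hypercube R q)
    (fun tau => A n * (kernel tau * (\prod_i tnth tau i)%:C ^+ n)).
  by apply: cintegrableMl => //; exact: (kernel_monomial n).1.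
have iF N : cintegrable (lebesgue_tuple R q) (hypercube R q) (F N).
  exact: cintegrable_sum.
have eF N : cintegral (lebesgue_tuple R q) (hypercube R q) (F N) =
    \sum_(n < N) A n * \prod_i (n`!%:R / pochhammer (b i) n.+1).
  rewrite cintegral_sum//; apply: eq_bigr => n _.
  by rewrite cintegralMl ?(kernel_monomial n).2//; exact: (kernel_monomial n).1.
pose dom tau := \prod_i cpow (1 - (tnth tau i)%:C) ((complex.Re (b i))%:C - 1).
have domE tau : hypercube R q tau -> dom tau = (normc (kernel tau))%:C.
  move=> tau01; rewrite normc_prod rmorph_prod; apply: eq_bigr => i _.
  by rewrite cpow_Re//; have /andP[] := tau01 i.
have idom : cintegrable (lebesgue_tuple R q) (hypercube R q) (fun tau => B%:C * dom tau).
  apply: cintegrableMl => //.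
  have [|i|] := @cintegral_tuple_prod R q (fun=> `]0, 1[%classic)
    (fun i x => cpow (1 - x%:C) ((complex.Re (b i))%:C - 1)).
  - by move=> _; exact: measurable_itv.
  - by have [] := @cintegral_cpow R (complex.Re (b i))%:C (b_gt0 i).
  by rewrite -hypercubeE.
have [|||ig cv] := cintegral_dominated (lebesgue_tuple R q) (hypercube R q) F g
    (fun tau => complex.Re (B%:C * dom tau)) mQ iF.
- move=> tau tau01; apply: ccvg_ext (ccvgMl (kernel tau) _ _ (Af _ tau01)) _ => N.
  by rewrite mulr_sumr; apply: eq_bigr => n _; ring.
- exact: idom.1.
- move=> N tau tau01; rewrite domE// -rmorphM /=.
  rewrite (_ : F N tau = (\sum_(n < N) A n * (\prod_i tnth tau i)%:C ^+ n) * kernel tau).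
    rewrite normcM ler_wpM2r ?normc_ge0//.
    apply: (le_trans (normc_sum _ _ _ _)); apply: le_trans (hB N).
    apply: ler_sum => n _; rewrite normcM normcX normc_real ler_piMr ?normc_ge0//.
    rewrite exprn_ile1// normr_prod; apply: prodr_ile1 => i _.
    by have /andP[t0 t1] := tau01 i; rewrite normr_ge0 ger0_norm ?ltW.
  by rewrite mulr_suml; apply: eq_bigr => n _; ring.
by split => //; apply: ccvg_ext cv _.
Qed.

End hypercube_integral.

(** * The range of [eta] and the integral representation *)

Lemma eta_ofX (R : realType) q (tau : q.-tuple R) : hypercube R q tau ->
  eta_of tau ^+ q.+1 = \prod_(i < q) tnth tau i.
Proof.
move=> tau01; have P0 : 0 <= \prod_(i < q) tnth tau i.
  by apply: prodr_ge0 => i _; have /andP[/ltW] := tau01 i.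
rewrite /eta_of -powR_mulrn ?powR_ge0// -powRrM mulVf ?pnatr_eq0//.
by rewrite powRr1.
Qed.

(** This is where [q >= 1] enters: an empty product would give [eta = 1], on the boundary of the
    disc of the binomial series. *)
Lemma eta_of_lt1 (R : realType) q (tau : q.-tuple R) : (0 < q)%N ->
  hypercube R q tau -> 0 <= eta_of tau < 1.
Proof.
move=> q0 tau01; rewrite powR_ge0/= ltNge; apply/negP => eta1.
have := exprn_ege1 q.+1 eta1; rewrite eta_ofX// leNgt => /negP; apply.
rewrite (bigD1 (Ordinal q0))//=; have /andP[t0 t1] := tau01 (Ordinal q0).
apply: le_lt_trans t1; rewrite ler_piMr ?(ltW t0)//; apply: prodr_ile1 => i _.
by have /andP[/ltW -> /ltW] := tau01 i.
Qed.

Theorem theorem2 (R : realType) (p q : nat) (hq : (1 <= q)%N) (hp : (p < q.+1)%N)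
    (alpha : 'I_p -> R[i]) (beta : 'I_q -> R[i])
    (hbeta : forall j, 1 < complex.Re (beta j))
    (t : R) (tkappa : R[i]) (htkappa : tkappa ^+ (q.+1 - p) = t%:C) :
  let C : R[i] := \prod_(i < q) (beta i - 1) in
  let omega (tau : q.-tuple R) : qform R q := fun a V =>
    \prod_(j < p) cpow (1 - a 0 (widen_ord (ltnW hp) j) * (eta_of tau)%:C) (- alpha j)
    * cexp ((eta_of tau)%:C * tkappa * \sum_(j < q.+1 | (p <= j)%N) a 0 j)
    * gelfand_leray a V in
  let integrand (tau : q.-tuple R) : R[i] :=
    \prod_(i < q) cpow (1 - (tnth tau i)%:C) (beta i - 2) * Res (omega tau) in
  cintegrable (lebesgue_tuple R q) (hypercube R q) integrand /\
  hypergeometric alpha beta t%:C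
  = C * cintegral (lebesgue_tuple R q) (hypercube R q) integrand.
Proof.
move=> C omega integrand.
(* The Beta integrals are used at [b = beta - 1], for which [(1 - tau)^(b - 1)] is the kernel
   [(1 - tau)^(beta - 2)]. *)
have b_gt0 i : 0 < complex.Re (beta i - 1) by rewrite cReD cReN /= subr_gt0.
pose A n := \prod_(i < p) pochhammer (alpha i) n * (tkappa ^+ (q.+1 - p)) ^+ n
  / n`!%:R ^+ q.+1.
have cvR tau : hypercube R q tau ->
    ccvg (fun N => \sum_(n < N) A n * (\prod_i tnth tau i)%:C ^+ n) (Res (omega tau)).
  move=> tau01; rewrite -eta_ofX//.
  exact: Res_confluent (eta_of_lt1 _ _ _ hq tau01).
have [ig cv] := cintegral_hypercube _ _ b_gt0 A (fun tau => Res (omega tau))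
  (summable_confluent _ _ hp alpha tkappa) cvR.
have gE : (fun tau => \prod_i cpow (1 - (tnth tau i)%:C) (beta i - 1 - 1) * Res (omega tau))
    = integrand.
  apply/funext => tau; congr (_ * _); apply: eq_bigr => i _.
  by congr cpow; rewrite -addrA -opprD.
rewrite gE in ig cv; split => //.
rewrite /hypergeometric; apply: (cvg_lim (@norm_hausdorff R[i] R[i]^o)).
apply: ccvg_cvg; apply: ccvg_ext (ccvgMl C _ _ cv) _ => N.
rewrite /series /= big_mkord mulr_sumr; apply: eq_bigr => n _.
(* The factors [beta i - 1] split off here cancel [C], and the [q] factorials from the Beta
   integrals reduce [n!^(q+1)] to the [n!] of the hypergeometric series. *)
have betaE i : pochhammer (beta i - 1) n.+1 = (beta i - 1) * pochhammer (beta i) n.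
  by rewrite pochhammerSl subrK.
rewrite (eq_bigr (fun i => n`!%:R * ((beta i - 1) * pochhammer (beta i) n)^-1)); last first.
  by move=> i _; rewrite betaE.
rewrite big_split/= prodr_const card_ord prodfV big_split/= -/C.
have C0 : C != 0.
  apply/prodf_neq0 => i _; apply: contraTneq (b_gt0 i) => ->; by rewrite ltxx.
have B0 : \prod_(i < q) pochhammer (beta i) n != 0.
  apply/prodf_neq0 => i _; apply: pochhammer_neq0.
  by rewrite (lt_trans _ (hbeta i)).
have n0 : n`!%:R != 0 :> R[i] by rewrite pnatr_eq0 -lt0n fact_gt0.
rewrite /A htkappa exprS; field.
by rewrite C0 B0 n0 expf_neq0.
Qed.
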